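(* Let $G$ be a locally compact group, let $B$ be a unital C$^*$-algebra, and let $\psi:G\to\operatorname{Pic}(B)$ be a topological Picard homomorphism. Moreover, let $(\mathcal{B},G,\pi)$ be a saturated Fell bundle with unit fiber $B$ and Picard homomorphism $\psi$, and let $\Gamma$ be a fundamental family of sections of $\pi:\mathcal{B}\to G$. Then the map $$H^2_c(G,UZ(B))_\psi\times\operatorname{Ext}(G,B,\psi,[\Gamma])\to\operatorname{Ext}(G,B,\psi,[\Gamma]),\qquad\big([\omega],[\mathcal{B}((B_g,\Psi_{g,h})_{g,h\in G})]\big)\mapsto[\mathcal{B}((B_g,\omega\Psi_{g,h})_{g,h\in G})]$$ is a well-defined simply transitive action. Here $(\omega\Psi)_{g,h}:=\omega(g,h)\Psi_{g,h}$, i.e. $\Psi_{g,h}$ followed by left multiplication by $\omega(g,h)$ on $B_{gh}$.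
   Context: All topological spaces are Hausdorff. A Banach bundle $(\mathcal{B},X,\pi)$ consists of a topological space $\mathcal{B}$, a locally compact space $X$ and a continuous open surjection $\pi:\mathcal{B}\to X$ whose fibers $B_x=\pi^{-1}(x)$ are complex Banach spaces, such that: $s\mapsto\|s\|$ is continuous; $(s,t)\mapsto s+t$ is continuous on $\{(s,t):\pi(s)=\pi(t)\}$; $s\mapsto\lambda s$ is continuous for each $\lambda\in\mathbb{C}$; and if $(s_i)$ is a net with $\|s_i\|\to0$ and $\pi(s_i)\to x$, then $s_i\to0_x$. Two Banach bundles over $X$ are equivalent if there is a homeomorphism between their total spaces mapping fibers to fibers (over the same point) by linear isometries. A Fell bundle is a Banach bundle $(\mathcal{B},G,\pi)$ over a locally compact group with a continuous associative multiplication and a continuous involution such that: $B_gB_h\subseteq B_{gh}$, bilinearly; $\|st\|\le\|s\|\|t\|$; $B_g^*\subseteq B_{g^{-1}}$, antilinearly; $(st)^*=t^*s^*$; $(s^* )^*=s$; $\|s^*s\|=\|s\|^2$; $s^*s\ge0$ in the C$^*$-algebra $B_e$ (the unit fiber). It is saturated if $\operatorname{span}\{B_gB_h\}$ is dense in $B_{gh}$ for all $g,h$. Two saturated Fell bundles over $G$ with unit fiber $B$ are equivalent if there is an equivalence $\Psi$ of the underlying Banach bundles with $\Psi_e=\operatorname{id}_B$, $\Psi_g(s)\Psi_h(t)=\Psi_{gh}(st)$ and $\Psi_g(s)^*=\Psi_{g^{-1}}(s^* )$, where $\Psi_g:=\Psi|_{B^1_g}$. A Morita equivalence $B$-bimodule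 is a $B$-$B$ imprimitivity bimodule; isomorphisms are bimodule isomorphisms preserving both inner products. $\operatorname{Pic}(B)$ is the group of isomorphism classes under $\otimes_B$. The fibers of a saturated Fell bundle with unit fiber $B$ are Morita equivalence $B$-bimodules (${}_B\langle s,t\rangle=st^*$, $\langle s,t\rangle_B=s^*t$), and its Picard homomorphism is $g\mapsto[B_g]$. A homomorphism $\psi:G\to\operatorname{Pic}(B)$ is a topological Picard homomorphism if there is a saturated Fell bundle over the locally compact group $G$ with unit fiber $B$ and Picard homomorphism $\psi$. A fundamental family of sections of $\pi:\mathcal{B}\to G$ is a $*$-algebra $\Gamma$ of compactly supported sections, with respect to $(\sigma*\sigma')(g)=\int_G\sigma(h)\sigma'(h^{-1}g)\,d\lambda(h)$ and $\sigma^*(g)=\Delta(g^{-1})\sigma(g^{-1})^*$ ($\lambda$ a left Haar measure, $\Delta$ the modular function), such that $\{\sigma(g):\sigma\in\Gamma\}$ is dense in $B_g$ for each $g$ and $g\mapsto\|\sigma(g)\|$ is continuous for each $\sigma\in\Gamma$. The topology determined by $\Gamma$ is the unique topology on $\mathcal{B}$ making it a Fell bundle with all sections in $\Gamma$ continuous; fundamental families are equivalent if they induce equivalent topologies, and $[\Gamma]$ denotes the equivalence class. $\operatorname{Ext}(G,B,\psi,[\Gamma])$ is the set of equivalence classes of saturated Fell bundles over $G$ with unit fiber $B$, Picard homomorphism $\psi$, and whose underlying Banach bundle is equivalent to $\mathcal{B}$ with the topology determined by $\Gamma$. A factor system for $\psi$ is a family $(B_g,\Psi_{g,h})_{g,h\in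 G}$, where each $B_g$ represents $\psi(g)$, $B_e=B$, and $\Psi_{g,h}:B_g\otimes_BB_h\to B_{gh}$ are isomorphisms of Morita equivalence $B$-bimodules, $\Psi_{e,e}=\operatorname{id}_B$, with $\Psi_{gh,k}\circ(\Psi_{g,h}\otimes\operatorname{id}_k)=\Psi_{g,hk}\circ(\operatorname{id}_g\otimes\Psi_{h,k})$. $\mathcal{B}((B_g,\Psi_{g,h})_{g,h\in G})$ denotes $\bigcup_gB_g$ with multiplication $st=\Psi_{g,h}(s\otimes t)$ and involution $s^*=\lambda_s^*(1_B)$ for $s\in B_g$, where $\lambda_s:B_{g^{-1}}\to B$, $\lambda_s(t)=\Psi_{g,g^{-1}}(s\otimes t)$. In the claim, the $B_g$ are the fibers of the given bundle $\mathcal{B}$, the total space carries the topology determined by $\Gamma$, and classes in $\operatorname{Ext}(G,B,\psi,[\Gamma])$ are represented by Fell bundles of this form. $UZ(B)$ is the group of unitaries of the center of $B$ (norm topology). For a Morita equivalence $B$-bimodule $M$ and $u\in UZ(B)$, $\psi_M(u)\in UZ(B)$ is the unique element with $\psi_M(u)m=mu$ for all $m\in M$; $\mu:\operatorname{Pic}(B)\to\operatorname{Aut}(UZ(B))$, $[M]\mapsto\psi_M$, is a homomorphism, and $\mu\circ\psi$ gives a continuous $G$-action on $UZ(B)$. $H^2_c(G,UZ(B))_\psi=Z^2_c(G,UZ(B))_\psi/B^2_c(G,UZ(B))_\psi$ is the group cohomology of this module computed with (globally) continuous normalized cochains $G^p\to UZ(B)$ (equal to $1_B$ whenever one argument is 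$e$).
   Formalization: Ext is restricted to classes represented by B((B_g,Ψ_{g,h})) on the fibers of the given bundle with the topology determined by Γ (mere Banach bundle equivalence does not ensure this, and transitivity then fails); that topology is assumed to exist. *)

(* Defs.v *)
From HB Require Import structures.
From mathcomp Require Import all_boot all_order all_algebra.
From mathcomp Require Import all_classical all_reals all_analysis.
From mathcomp Require Import complex.
Set Implicit Arguments.
Unset Strict Implicit.
Unset Printing Implicit Defensive.
Import Order.TTheory GRing.Theory Num.Theory.
Import numFieldNormedType.Exports.
Local Open Scope classical_set_scope.
Local Open Scope complex_scope.
Local Open Scope ring_scope.

(* The complex numbers are R[i] for R : realType, so the library norm of a
   complex normed space takes its values in R[i]; rnorm is the same norm, with
   values in R. *)
Definition rnorm (R : realType) (V : normedModType R[i]) (x : V) : R :=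
  complex.Re `|x|.

Definition lspan (K : nzRingType) (V : lmodType K) (A : set V) : set V :=
  [set v | exists n (a : 'I_n -> K) (x : 'I_n -> V),
    (forall i, A (x i)) /\ v = \sum_i a i *: x i].

HB.mixin Record isTopologicalGroup G & Topological G & Group G := {
  mulg_continuous : continuous (fun p : G * G => (p.1 * p.2)%g) ;
  invg_continuous : continuous (fun x : G => (x^-1)%g)
}.

#[short(type="topGroupType")]
HB.structure Definition TopologicalGroup :=
  {G of Topological G & Group G & isTopologicalGroup G}.

(* measurableType requires a pointed carrier; a group is pointed by 1. *)
Definition pointed_group (G : topGroupType) : Type := G.
HB.instance Definition _ (G : topGroupType) := Choice.on (pointed_group G).
HB.instance Definition _ (G : topGroupType) :=
  isPointed.Build (pointed_group G) (1%g : G).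

Definition borel (G : topGroupType) :=
  g_sigma_algebraType (@open G : set (set (pointed_group G))).

(* A left Haar measure, as a left invariant nonzero Radon measure. *)
Record left_haar (R : realType) (G : topGroupType)
    (mu : {measure set (borel G) -> \bar R}) : Prop := {
  haar_invariant : forall (g : G) (E : set (borel G)), measurable E ->
    mu ((fun x : G => g * x)%g @` E) = mu E ;
  haar_neq0 : mu setT != 0%E ;
  haar_compact : forall K : set G, compact K -> (mu K < +oo)%E ;
  haar_outer : forall E : set (borel G), measurable E ->
    mu E = ereal_inf [set mu U | U in [set U : set G | open U /\ E `<=` U]] ;
  haar_inner : forall U : set G, open U ->
    mu U = ereal_sup [set mu K | K in [set K : set G | compact K /\ K `<=` U]]
}.

Definition modular_function (R : realType) (G : topGroupType)
    (mu : {measure set (borel G) -> \bar R}) (Delta : G -> R) : Prop :=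
  forall g, 0 < Delta g /\ forall E : set (borel G), measurable E ->
    mu ((fun x : G => x * g)%g @` E) = ((Delta g)%:E * mu E)%E.

Record simple (R : realType) (G : topGroupType) (V : normedModType R[i]) :=
  Simple {
    simple_len : nat ;
    simple_set : 'I_simple_len -> set (borel G) ;
    simple_val : 'I_simple_len -> V }.

Definition simple_fun (R : realType) (G : topGroupType)
    (V : normedModType R[i]) (s : simple G V) (x : G) : V :=
  \sum_i (\1_(simple_set (s := s) i) x : R)%:C *: simple_val i.

Definition simple_integral (R : realType) (G : topGroupType)
    (V : normedModType R[i]) (mu : {measure set (borel G) -> \bar R})
    (s : simple G V) : V :=
  \sum_i (fine (mu (simple_set (s := s) i)))%:C *: simple_val i.

(* v is the Bochner integral of f; the sets of a simple function may overlap. *)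
Definition bochner_integral (R : realType) (G : topGroupType)
    (V : normedModType R[i]) (mu : {measure set (borel G) -> \bar R})
    (f : G -> V) (v : V) : Prop :=
  exists s : nat -> simple G V,
  [/\ forall n i, measurable (simple_set (s := s n) i) /\
        (mu (simple_set (s := s n) i) < +oo)%E,
      forall n, measurable_fun setT
        (fun x : borel G => rnorm (f x - simple_fun (s n) x)),
      (fun n => \int[mu]_x (rnorm (f x - simple_fun (s n) x))%:E)%E @ \oo
        --> 0%E &
      simple_integral mu (s n) @[n --> \oo] --> v].

(* The multiplicative structure is not taken from GRing.PzRing, because the
   hierarchy has no join of rings and normed modules. *)
HB.mixin Record isCStarAlgebra (R : realType) A
    & CompleteNormedModule R[i] A := {
  cmul : A -> A -> A ;
  cone : A ;
  star : A -> A ;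
  cmulA : associative cmul ;
  cmul1l : left_id cone cmul ;
  cmul1r : right_id cone cmul ;
  cmul_linl : forall y : A, linear (fun x => cmul x y) ;
  cmul_linr : forall x : A, linear (cmul x) ;
  starD : forall x y : A, star (x + y) = star x + star y ;
  starZ : forall (k : R[i]) (x : A), star (k *: x) = (k^*)%C *: star x ;
  starM : forall x y : A, star (cmul x y) = cmul (star y) (star x) ;
  starK : forall x : A, star (star x) = x ;
  cmul_norm : forall x y : A, `|cmul x y| <= `|x| * `|y| ;
  cstar_identity : forall x : A, `|cmul (star x) x| = `|x| ^+ 2
}.

#[short(type="cstarAlgType")]
HB.structure Definition CStarAlgebra (R : realType) :=
  {A of CompleteNormedModule R[i] A & isCStarAlgebra R A}.

Notation "x \cdot y" := (cmul x y) (at level 40, left associativity).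

Section CStarAlgebra.
Variables (R : realType) (B : cstarAlgType R).

Definition spectrum (a : B) : set R[i] :=
  [set z | ~ exists b : B, b \cdot (a - z *: cone) = cone /\
    (a - z *: cone) \cdot b = cone].

Definition cstar_ge0 (a : B) : Prop :=
  star a = a /\ spectrum a `<=` [set z | 0 <= z].

Definition UZ : set B :=
  [set u | [/\ star u \cdot u = cone, u \cdot star u = cone &
    forall b : B, u \cdot b = b \cdot u]].

Record bimod := Bimod {
  bimod_car :> completeNormedModType R[i] ;
  lact : B -> bimod_car -> bimod_car ;
  ract : bimod_car -> B -> bimod_car ;
  lip : bimod_car -> bimod_car -> B ;
  rip : bimod_car -> bimod_car -> B }.

Record imprimitivity_bimodule (M : bimod) : Prop := {
  lact1 : forall x : M, lact cone x = x ;
  lactM : forall (a b : B) (x : M), lact (a \cdot b) x = lact a (lact b x) ;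
  lactDl : forall (a b : B) (x : M), lact (a + b) x = lact a x + lact b x ;
  lactDr : forall (a : B) (x y : M), lact a (x + y) = lact a x + lact a y ;
  lactZl : forall (k : R[i]) (a : B) (x : M), lact (k *: a) x = k *: lact a x ;
  lactZr : forall (k : R[i]) (a : B) (x : M), lact a (k *: x) = k *: lact a x ;
  ract1 : forall x : M, ract x cone = x ;
  ractM : forall (x : M) (a b : B), ract x (a \cdot b) = ract (ract x a) b ;
  ractDr : forall (x : M) (a b : B), ract x (a + b) = ract x a + ract x b ;
  ractDl : forall (x y : M) (a : B), ract (x + y) a = ract x a + ract y a ;
  ractZr : forall (k : R[i]) (x : M) (a : B), ract x (k *: a) = k *: ract x a ;
  ractZl : forall (k : R[i]) (x : M) (a : B), ract (k *: x) a = k *: ract x a ;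
  lractA : forall (a : B) (x : M) (b : B),
    ract (lact a x) b = lact a (ract x b) ;
  lipD : forall x y z : M, lip (x + y) z = lip x z + lip y z ;
  lipZ : forall (k : R[i]) (x y : M), lip (k *: x) y = k *: lip x y ;
  lip_lact : forall (b : B) (x y : M), lip (lact b x) y = b \cdot lip x y ;
  lip_star : forall x y : M, star (lip x y) = lip y x ;
  lip_ge0 : forall x : M, cstar_ge0 (lip x x) ;
  lip_norm : forall x : M, `|x| ^+ 2 = `|lip x x| ;
  lip_full : dense (lspan [set lip p.1 p.2 | p in [set: M * M]]) ;
  ripD : forall x y z : M, rip x (y + z) = rip x y + rip x z ;
  ripZ : forall (k : R[i]) (x y : M), rip x (k *: y) = k *: rip x y ;
  rip_ract : forall (x y : M) (b : B), rip x (ract y b) = rip x y \cdot b ;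
  rip_star : forall x y : M, star (rip x y) = rip y x ;
  rip_ge0 : forall x : M, cstar_ge0 (rip x x) ;
  rip_norm : forall x : M, `|x| ^+ 2 = `|rip x x| ;
  rip_full : dense (lspan [set rip p.1 p.2 | p in [set: M * M]]) ;
  rip_lact : forall (b : B) (x y : M),
    rip (lact b x) y = rip x (lact (star b) y) ;
  lip_ract : forall (x y : M) (b : B),
    lip (ract x b) y = lip x (ract y (star b)) ;
  lip_rip : forall x y z : M, lact (lip x y) z = ract x (rip y z)
}.

Definition self_bimod : bimod :=
  @Bimod B (fun a x => a \cdot x) (fun x a => x \cdot a)
    (fun x y => x \cdot star y) (fun x y => star x \cdot y).

Record bimod_iso (M N : bimod) (f : M -> N) : Prop := {
  bimod_iso_linear : linear f ;
  bimod_iso_bij : bijective f ;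
  bimod_iso_lact : forall (b : B) (x : M), f (lact b x) = lact b (f x) ;
  bimod_iso_ract : forall (x : M) (b : B), f (ract x b) = ract (f x) b ;
  bimod_iso_lip : forall x y : M, lip (f x) (f y) = lip x y ;
  bimod_iso_rip : forall x y : M, rip (f x) (f y) = rip x y }.

(* Isomorphism classes of bundled structures are predicates T -> Prop, because
   universe constraints rule out the library's set T for such T. *)
Definition pic_class (M : bimod) : bimod -> Prop :=
  fun N => imprimitivity_bimodule N /\ exists f : M -> N, bimod_iso f.

Definition is_pic (c : bimod -> Prop) : Prop :=
  exists2 M, imprimitivity_bimodule M & c = pic_class M.

(* An isomorphism M (x)_B N -> P of Morita equivalence bimodules, given by its
   values t m n on the elementary tensors m (x) n.  The internal tensor product
   is the completion of the balanced algebraic one for the two inner products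
   below, so that such a t extends uniquely to an isometric bimodule map, which
   is onto if and only if the range of t spans a dense subspace of P. *)
Record tensor_iso (M N P : bimod) (t : M -> N -> P) : Prop := {
  tensor_linl : forall n, linear (fun m => t m n) ;
  tensor_linr : forall m, linear (t m) ;
  tensor_balanced : forall m b n, t (ract m b) n = t m (lact b n) ;
  tensor_lact : forall b m n, t (lact b m) n = lact b (t m n) ;
  tensor_ract : forall m n b, t m (ract n b) = ract (t m n) b ;
  tensor_lip : forall m n m' n',
    lip (t m n) (t m' n') = lip (ract m (lip n n')) m' ;
  tensor_rip : forall m n m' n',
    rip (t m n) (t m' n') = rip n (lact (rip m m') n') ;
  tensor_dense : dense (lspan [set t p.1 p.2 | p in [set: M * N]]) }.

(* e = c d in Pic(B) *)
Definition pic_mul (c d e : bimod -> Prop) : Prop :=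
  exists (M N P : bimod) (t : M -> N -> P), [/\ c M, d N, e P & tensor_iso t].

Definition picard_morphism (G : topGroupType) (psi : G -> bimod -> Prop) :
    Prop :=
  (forall g, is_pic (psi g)) /\
  (forall g h, pic_mul (psi g) (psi h) (psi (g * h)%g)).

Definition adjoint (M N : bimod) (T : M -> N) (T' : N -> M) : Prop :=
  forall m n, rip (T m) n = rip m (T' n).

End CStarAlgebra.

Arguments lact {R B} _ _ _.
Arguments ract {R B} _ _ _.
Arguments lip {R B} _ _ _.
Arguments rip {R B} _ _ _.

Record topology_on (T : Type) := TopologyOn {
  topen : set (set T) ;
  topenT : topen setT ;
  topenI : setI_closed topen ;
  topen_bigcup : forall F : set (set T), F `<=` topen ->
    topen (\bigcup_(U in F) U) }.

Lemma topen_bigU (T : Type) (tau : topology_on T) (I : Type) (f : I -> set T) :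
  (forall i, topen tau (f i)) -> topen tau (\bigcup_i f i).
Proof.
move=> fo; rewrite -(bigcup_image setT f id).
by apply: topen_bigcup => _ [i _ <-].
Qed.

Definition with_top (T : choiceType) (tau : topology_on T) : Type := T.
HB.instance Definition _ (T : choiceType) (tau : topology_on T) :=
  Choice.on (with_top tau).
HB.instance Definition _ (T : choiceType) (tau : topology_on T) :=
  isOpenTopological.Build (with_top tau)
    (topenT tau) (@topenI _ tau) (@topen_bigU _ tau).

Section Bundles.
Variables (R : realType) (G : topGroupType).

(* The disjoint union of the fibers; the bundle projection is tag. *)
Definition total_space (fib : G -> completeNormedModType R[i]) : Type :=
  {g : G & fib g}.
HB.instance Definition _ (fib : G -> completeNormedModType R[i]) :=
  Choice.on (total_space fib).

Definition intot (fib : G -> completeNormedModType R[i]) (g : G) (s : fib g) :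
  total_space fib := existT _ g s.

Definition fcast (fib : G -> completeNormedModType R[i]) (g h : G)
  (e : g = h) (s : fib g) : fib h := eq_rect g (fun k => fib k : Type) s h e.

(* Meaningful only if s and t lie in the same fiber. *)
Definition tadd (fib : G -> completeNormedModType R[i]) (s t : total_space fib)
  : total_space fib := intot (tagged s + tagged_as s t).

Definition tscale (fib : G -> completeNormedModType R[i]) (k : R[i])
  (s : total_space fib) : total_space fib := intot (k *: tagged s).

Definition tnorm (fib : G -> completeNormedModType R[i]) (s : total_space fib) :
  R :=
  rnorm (tagged s).

(* In zero_limit, proper filters play the role of nets. *)
Record banach_bundle (fib : G -> completeNormedModType R[i])
    (tau : topology_on (total_space fib)) : Prop := {
  total_hausdorff : hausdorff_space (with_top tau) ;
  proj_continuous : continuous (fun s : with_top tau => tag s) ;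
  proj_open : forall U : set (with_top tau), open U ->
    open [set tag s | s in U] ;
  tnorm_continuous : continuous (fun s : with_top tau => tnorm s) ;
  tadd_continuous :
    {within [set p : with_top tau * with_top tau | tag p.1 = tag p.2],
      continuous (fun p : with_top tau * with_top tau =>
        tadd p.1 p.2 : with_top tau)} ;
  tscale_continuous : forall k : R[i],
    continuous (fun s : with_top tau => tscale k s : with_top tau) ;
  zero_limit : forall (F : set_system (with_top tau)) (g : G),
    ProperFilter F ->
    (fun s : with_top tau => tnorm s) @ F --> (0 : R) ->
    (fun s : with_top tau => tag s) @ F --> g ->
    F --> (intot (0 : fib g) : with_top tau) }.

Definition total_map (fib fib' : G -> completeNormedModType R[i])
    (Phi : forall g, fib g -> fib' g) (s : total_space fib) :
    total_space fib' :=
  intot (Phi (tag s) (tagged s)).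

Record banach_equivalence (fib fib' : G -> completeNormedModType R[i])
    (tau : topology_on (total_space fib))
    (tau' : topology_on (total_space fib'))
    (Phi : forall g, fib g -> fib' g) : Prop := {
  bequiv_linear : forall g, linear (Phi g) ;
  bequiv_isometry : forall g (s : fib g), `|Phi g s| = `|s| ;
  bequiv_bij : forall g, bijective (Phi g) ;
  bequiv_continuous :
    continuous (fun s : with_top tau => total_map Phi s : with_top tau') ;
  bequiv_open : forall U : set (with_top tau), open U ->
    open ([set total_map Phi s | s in U] : set (with_top tau')) }.

Definition banach_equivalent (fib fib' : G -> completeNormedModType R[i])
    (tau : topology_on (total_space fib))
    (tau' : topology_on (total_space fib')) : Prop :=
  exists Phi : forall g, fib g -> fib' g, banach_equivalence tau tau' Phi.

Variable B : cstarAlgType R.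

(* That the unit fiber is B is expressed by the identification funit. *)
Record fell_data := FellData {
  fib : G -> completeNormedModType R[i] ;
  ftop : topology_on (total_space fib) ;
  fmul : forall g h, fib g -> fib h -> fib (g * h)%g ;
  fstar : forall g, fib g -> fib (g^-1)%g ;
  funit : B -> fib 1%g }.

Definition tmul (F : fell_data) (s t : total_space (fib F)) : total_space (fib F) :=
  intot (fmul (tagged s) (tagged t)).

Definition tstar (F : fell_data) (s : total_space (fib F)) : total_space (fib F) :=
  intot (fstar (tagged s)).

Record fell_bundle (F : fell_data) : Prop := {
  fell_banach : banach_bundle (ftop F) ;
  fmul_continuous :
    continuous (fun p : with_top (ftop F) * with_top (ftop F) =>
      tmul p.1 p.2 : with_top (ftop F)) ;
  fmulA : forall r s t : total_space (fib F),
    tmul r (tmul s t) = tmul (tmul r s) t ;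
  fstar_continuous :
    continuous (fun s : with_top (ftop F) => tstar s : with_top (ftop F)) ;
  fmul_linl : forall g h (t : fib F h), linear (fun s : fib F g => fmul s t) ;
  fmul_linr : forall g h (s : fib F g), linear (fun t : fib F h => fmul s t) ;
  fmul_norm : forall g h (s : fib F g) (t : fib F h),
    `|fmul s t| <= `|s| * `|t| ;
  fstarD : forall g (s t : fib F g), fstar (s + t) = fstar s + fstar t ;
  fstarZ : forall g (k : R[i]) (s : fib F g),
    fstar (k *: s) = (k^*)%C *: fstar s ;
  fstarM : forall s t : total_space (fib F),
    tstar (tmul s t) = tmul (tstar t) (tstar s) ;
  fstarK : forall s : total_space (fib F), tstar (tstar s) = s ;
  fstar_identity : forall g (s : fib F g), `|fmul (fstar s) s| = `|s| ^+ 2 ;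
  funit_linear : linear (funit F) ;
  funit_bij : bijective (funit F) ;
  funit_norm : forall b, `|funit F b| = `|b| ;
  funitM : forall a b : B,
    intot (funit F (a \cdot b)) = tmul (intot (funit F a)) (intot (funit F b)) ;
  funit_star : forall b : B,
    intot (funit F (star b)) = tstar (intot (funit F b)) ;
  fell_ge0 : forall s : total_space (fib F), exists2 b : B, cstar_ge0 b &
    tmul (tstar s) s = intot (funit F b) }.

Definition saturated_fell_bundle (F : fell_data) : Prop :=
  fell_bundle F /\ forall g h,
    dense (lspan [set fmul p.1 p.2 | p in [set: fib F g * fib F h]]).

Record fell_equivalence (F F' : fell_data)
    (Phi : forall g, fib F g -> fib F' g) : Prop := {
  fequiv_banach : banach_equivalence (ftop F) (ftop F') Phi ;
  fequiv_unit : forall b, Phi 1%g (funit F b) = funit F' b ;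
  fequivM : forall g h (s : fib F g) (t : fib F h),
    fmul (Phi g s) (Phi h t) = Phi (g * h)%g (fmul s t) ;
  fequiv_star : forall g (s : fib F g),
    fstar (Phi g s) = Phi (g^-1)%g (fstar s) }.

Definition fell_equivalent (F F' : fell_data) : Prop :=
  exists Phi : forall g, fib F g -> fib F' g, fell_equivalence Phi.

Definition fell_class (F : fell_data) : fell_data -> Prop :=
  fun F' => saturated_fell_bundle F' /\ fell_equivalent F F'.

(* iota is an identification of B with a unit fiber, so b is unique. *)
Definition unit_inv (V : Type) (iota : B -> V) (x : V) : B :=
  xget 0 [set b | iota b = x].

Definition fiber_bimod (F : fell_data) (g : G) : bimod B :=
  @Bimod R B (fib F g)
    (fun b s => fcast (mul1g g) (fmul (funit F b) s))
    (fun s b => fcast (mulg1 g) (fmul s (funit F b)))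
    (fun s t => unit_inv (funit F) (fcast (mulgV g) (fmul s (fstar t))))
    (fun s t => unit_inv (funit F) (fcast (mulVg g) (fmul (fstar s) t))).

Definition picard (F : fell_data) : G -> bimod B -> Prop :=
  fun g => pic_class (fiber_bimod F g).

Definition topological_picard_morphism (psi : G -> bimod B -> Prop) : Prop :=
  picard_morphism psi /\
  exists2 F, saturated_fell_bundle F & picard F = psi.

Definition convolution (F : fell_data)
    (mu : {measure set (borel G) -> \bar R})
    (sigma sigma' rho : forall g, fib F g) : Prop :=
  forall g, bochner_integral mu
    (fun h : G => fcast (mulVKg h g) (fmul (sigma h) (sigma' (h^-1 * g)%g)))
    (rho g).

Definition section_star (F : fell_data) (Delta : G -> R)
    (sigma : forall g, fib F g) (g : G) : fib F g :=
  (Delta (g^-1)%g)%:C *: fcast (invgK g) (fstar (sigma (g^-1)%g)).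

Record fundamental_family (F : fell_data)
    (mu : {measure set (borel G) -> \bar R}) (Delta : G -> R)
    (Gamma : set (forall g, fib F g)) : Prop := {
  family_support : forall sigma, Gamma sigma ->
    compact (closure [set g | sigma g != 0]) ;
  family0 : Gamma (fun g => 0) ;
  familyD : forall sigma sigma', Gamma sigma -> Gamma sigma' ->
    Gamma (fun g => sigma g + sigma' g) ;
  familyZ : forall (k : R[i]) sigma, Gamma sigma ->
    Gamma (fun g => k *: sigma g) ;
  family_convolution : forall sigma sigma', Gamma sigma -> Gamma sigma' ->
    exists2 rho, Gamma rho & convolution mu sigma sigma' rho ;
  family_star : forall sigma, Gamma sigma -> Gamma (section_star Delta sigma) ;
  family_dense : forall g, dense [set sigma g | sigma in Gamma] ;
  family_norm : forall sigma, Gamma sigma ->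
    continuous (fun g => rnorm (sigma g)) }.

Definition retop (F : fell_data) (tau : topology_on (total_space (fib F))) :
  fell_data := FellData tau (@fmul F) (@fstar F) (funit F).

Definition topology_determined_by (F : fell_data)
    (Gamma : set (forall g, fib F g))
    (tau : topology_on (total_space (fib F))) : Prop :=
  fell_bundle (retop tau) /\
  forall sigma, Gamma sigma ->
    continuous (fun g => intot (sigma g) : with_top tau).

(* iota expresses that M 1 = B, and Psi g h is given on elementary tensors. *)
Record factor_system (psi : G -> bimod B -> Prop) (M : G -> bimod B)
    (iota : B -> M 1%g)
    (Psi : forall g h, M g -> M h -> M (g * h)%g) : Prop := {
  factor_psi : forall g, psi g (M g) ;
  factor_unit : bimod_iso (M := self_bimod B) iota ;
  factor_iso : forall g h, tensor_iso (Psi g h) ;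
  factor_11 : forall a b : B,
    intot (fib := M) (Psi _ _ (iota a) (iota b)) =
    intot (fib := M) (iota (a \cdot b)) ;
  factorA : forall g h k (r : M g) (s : M h) (t : M k),
    intot (fib := M) (Psi _ _ (Psi _ _ r s) t) =
    intot (fib := M) (Psi _ _ r (Psi _ _ s t)) }.

Definition factor_lambda (M : G -> bimod B) (iota : B -> M 1%g)
    (Psi : forall g h, M g -> M h -> M (g * h)%g) (g : G) (s : M g)
    (t : M (g^-1)%g) : self_bimod B :=
  unit_inv iota (fcast (fib := M) (mulgV g) (Psi g (g^-1)%g s t)).

Definition factor_star (M : G -> bimod B) (iota : B -> M 1%g)
    (Psi : forall g h, M g -> M h -> M (g * h)%g) (g : G) (s : M g) :
    M (g^-1)%g :=
  xget 0 [set t | exists2 T : self_bimod B -> M (g^-1)%g,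
    adjoint (factor_lambda iota Psi s) T & t = T (cone : B)].

Definition factor_bundle (M : G -> bimod B) (iota : B -> M 1%g)
    (tau : topology_on (total_space M))
    (Psi : forall g h, M g -> M h -> M (g * h)%g) : fell_data :=
  @FellData M tau Psi (factor_star iota Psi) iota.

Definition twist (M : G -> bimod B) (omega : G -> G -> B)
    (Psi : forall g h, M g -> M h -> M (g * h)%g) :
    forall g h, M g -> M h -> M (g * h)%g :=
  fun g h s t => lact (M (g * h)%g) (omega g h) (Psi g h s t).

Definition fell_factor_system (psi : G -> bimod B -> Prop) (F : fell_data)
    (tau : topology_on (total_space (fib F)))
    (Psi : forall g h, fib F g -> fib F h -> fib F (g * h)%g) : Prop :=
  factor_system psi (M := fiber_bimod F) (funit F) Psi /\
  saturated_fell_bundle (factor_bundle (M := fiber_bimod F) (funit F) tau Psi).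

(* The action of G on UZ(B): psi_M(u) m = m u for M in psi g. *)
Definition picard_act (psi : G -> bimod B -> Prop) (g : G) (u : B) : B :=
  xget cone [set v | UZ v /\
    forall M : bimod B, psi g M -> forall m : M, lact M v m = ract M m u].

Record cocycle2 (psi : G -> bimod B -> Prop) (omega : G -> G -> B) : Prop := {
  cocycle2_UZ : forall g h, UZ (omega g h) ;
  cocycle2_continuous : continuous (fun p : G * G => omega p.1 p.2) ;
  cocycle2_1l : forall g, omega 1%g g = cone ;
  cocycle2_1r : forall g, omega g 1%g = cone ;
  cocycle2_eq : forall g h k,
    picard_act psi g (omega h k) \cdot omega g (h * k)%g =
    omega (g * h)%g k \cdot omega g h }.

Record cochain1 (nu : G -> B) : Prop := {
  cochain1_UZ : forall g, UZ (nu g) ;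
  cochain1_continuous : continuous nu ;
  cochain1_1 : nu 1%g = cone }.

(* The inverse of a unitary u is star u. *)
Definition coboundary (psi : G -> bimod B -> Prop) (nu : G -> B) (g h : G) :
    B :=
  picard_act psi g (nu h) \cdot star (nu (g * h)%g) \cdot nu g.

Definition cohomologous (psi : G -> bimod B -> Prop)
    (omega omega' : G -> G -> B) : Prop :=
  exists2 nu, cochain1 nu &
    forall g h, omega' g h = omega g h \cdot coboundary psi nu g h.

Definition H2_class (psi : G -> bimod B -> Prop) (omega : G -> G -> B) :
    set (G -> G -> B) :=
  [set omega' | cocycle2 psi omega' /\ cohomologous psi omega omega'].

Definition H2 (psi : G -> bimod B -> Prop) : set (set (G -> G -> B)) :=
  [set H2_class psi omega | omega in cocycle2 psi].

Definition H2_one (psi : G -> bimod B -> Prop) : set (G -> G -> B) :=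
  H2_class psi (fun _ _ => cone).

Definition H2_mul (psi : G -> bimod B -> Prop) (c d : set (G -> G -> B)) :
    set (G -> G -> B) :=
  [set omega | cocycle2 psi omega /\ exists omega1 omega2, [/\ c omega1,
    d omega2 &
    cohomologous psi (fun g h => omega1 g h \cdot omega2 g h) omega]].

(* tau is the topology determined by Gamma.  The last condition is the
   convention that the classes are represented by Fell bundles of factor
   systems on the Morita equivalence bimodules B_g of F.  It does not follow
   from banach_equivalent, whose fiber maps are merely linear isometries. *)
Definition Ext (psi : G -> bimod B -> Prop) (F : fell_data)
    (tau : topology_on (total_space (fib F))) (c : fell_data -> Prop) : Prop :=
  exists2 E, c = fell_class E &
    [/\ saturated_fell_bundle E,
        picard E = psi,
        banach_equivalent (ftop E) tau &
        exists2 Psi, fell_factor_system psi tau Psi &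
          fell_equivalent E
            (factor_bundle (M := fiber_bimod F) (funit F) tau Psi)].

End Bundles.

(* Main.v *)
Require Import Defs.
From mathcomp Require Import all_boot all_order all_algebra.
From mathcomp Require Import all_classical all_reals all_analysis.
From mathcomp Require Import complex.
Set Implicit Arguments.
Unset Strict Implicit.
Unset Printing Implicit Defensive.
Import Order.TTheory GRing.Theory Num.Theory.
Import numFieldNormedType.Exports.
Local Open Scope classical_set_scope.
Local Open Scope ring_scope.

(** A saturated Fell bundle is a continuous version of a crossed product: its
    fibers are Morita equivalence bimodules, its product is a factor system, and
    its involution is determined by the product, because the star of s is the
    vector representing the functional t |-> s t.  Conversely every factor
    system satisfies the algebraic axioms of a Fell bundle
    (saturated_factor_bundle), so that only continuity distinguishes the two.

    The key algebraic fact is central_unitary: since B is unital, an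
    automorphism of an imprimitivity bimodule is multiplication by a central
    unitary of B.  It rests on frames, finite families of vectors with
    \sum_i lip (x i) (y i) = 1, which exist because the invertible elements of
    B fill a neighbourhood of 1; frames also reduce the density arguments to
    finite computations.

    - A cocycle omega moves past a vector of the fiber over g at the price of
      the action of psi g, so the cocycle equation is exactly the associativity
      of the twisted product (twist_factor_system); the twisted operations are
      continuous because multiplication by elements of B is multiplication by
      vectors of the unit fiber (twist_saturated).
    - Transitivity: two factor systems on the same bimodules differ over (g, h)
      by a central unitary omega g h, and the two associativity laws make omega
      a cocycle (factor_systems_differ_by_cocycle).
    - An equivalence between the twists by omega and omega' multiplies the fiber
      over g by a central unitary nu g, and its compatibility with products says
      that omega and omega' differ by the coboundary of a cochain
      (cohomologous_twist_equivalent); the converse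
      (twist_equivalent_cohomologous) makes the action well defined on classes.

    The analytic point is that the unitaries omega g h and nu g obtained in this
    way depend continuously on the group elements for the norm of B.  They are
    quotients of inner products of vectors that vary continuously, namely
    lip (u s) t against lip s t.  As the bundle projection is open, vectors over
    nearby points can be chosen near given ones, and a frame over the base point
    provides finitely many inner products with sum 1 (probe_continuous,
    probe_lift).

    Finally the set acted on is nonempty, since the bundle F with the topology
    tau is the Fell bundle of the factor system given by its own product
    (factor_bundle_fmul). *)

(** * Unital C*-algebras and their central unitaries *)

Section CStarAlgebra.
Variables (R : realType) (B : cstarAlgType R).
Implicit Types (a b c u v : B).

Lemma cmulDl a b c : (a + b) \cdot c = a \cdot c + b \cdot c.
Proof. by have := cmul_linl c 1 a b; rewrite !scale1r. Qed.

Lemma cmulDr a b c : c \cdot (a + b) = c \cdot a + c \cdot b.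
Proof. by have := cmul_linr c 1 a b; rewrite !scale1r. Qed.

Lemma cmulNl a c : (- a) \cdot c = - (a \cdot c).
Proof.
have l0 : (0 : B) \cdot c = 0.
  by apply: (@addrI _ (0 \cdot c)); rewrite -cmulDl !addr0.
by apply: (@addrI _ (a \cdot c)); rewrite -cmulDl !subrr.
Qed.

Lemma cmulNr a c : c \cdot (- a) = - (c \cdot a).
Proof.
have r0 : c \cdot (0 : B) = 0.
  by apply: (@addrI _ (c \cdot 0)); rewrite -cmulDr !addr0.
by apply: (@addrI _ (c \cdot a)); rewrite -cmulDr !subrr.
Qed.

Lemma cmulBl a b c : (a - b) \cdot c = a \cdot c - b \cdot c.
Proof. by rewrite cmulDl cmulNl. Qed.

Lemma cmulBr a b c : c \cdot (a - b) = c \cdot a - c \cdot b.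
Proof. by rewrite cmulDr cmulNr. Qed.

Lemma star1 : star (cone : B) = cone.
Proof.
by have := starM (star cone) (cone : B); rewrite cmul1r starK cmul1r.
Qed.

Lemma norm_cone_le1 : `|cone : B| <= 1.
Proof.
have := cstar_identity (cone : B); rewrite star1 cmul1l expr2.
have [->|n0] := eqVneq `|cone : B| 0; first by rewrite ler01.
by move/(congr1 (fun x => x / `|cone : B|)); rewrite mulfK// divff// => <-.
Qed.

Lemma norm_star a : `|star a| = `|a|.
Proof.
wlog suff le : a / `|a| <= `|star a|.
  by apply/eqP; rewrite eq_le le -{2}(starK a) le.
have [->|a0] := eqVneq a 0; first by rewrite normr0 normr_ge0.
have a_gt0 : 0 < `|a| by rewrite normr_gt0.
by rewrite -(ler_pM2r a_gt0) -expr2 -cstar_identity cmul_norm.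
Qed.

End CStarAlgebra.

Section UnitaryCentral.
Variables (R : realType) (B : cstarAlgType R).
Implicit Types (a b u v : B).

Lemma UZ_star u : UZ u -> UZ (star u).
Proof.
move=> [uu uu' uC]; split; rewrite ?starK// => b.
by rewrite -{1}(starK b) -starM -uC starM starK.
Qed.

Lemma UZ_mul u v : UZ u -> UZ v -> UZ (u \cdot v).
Proof.
move=> [uu uu' uC] [vv vv' vC]; split; last first.
- by move=> b; rewrite -cmulA vC !cmulA uC.
- by rewrite starM cmulA -(cmulA u v) vv' cmul1r.
- by rewrite starM cmulA -(cmulA (star v)) uu cmul1r.
Qed.

Lemma UZ1 : UZ (cone : B).
Proof. by split; rewrite ?star1 ?cmul1l// => b; rewrite cmul1l cmul1r. Qed.

Lemma UZ_norm_le u b : UZ u -> `|u \cdot b| <= `|b|.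
Proof.
move=> [uu _ _]; have u1 : `|u| <= 1.
  rewrite -(@ler_pXn2r _ 2)// ?nnegrE ?normr_ge0 ?ler01//.
  by rewrite -cstar_identity uu expr1n norm_cone_le1.
by apply: le_trans (cmul_norm _ _) _; rewrite ler_piMl.
Qed.

End UnitaryCentral.

Section NearOne.
Variables (R : realType) (B : cstarAlgType R).

Lemma half_expn_lt (e : R[i]) : 0 < e -> exists n, (2^-1 : R[i]) ^+ n < e.
Proof.
move=> e0.
have eE : e = (complex.Re e)%:C%C by rewrite RRe_real// ger0_real// ltW.
have Re0 : 0 < complex.Re e by rewrite -ltcR -eE.
have h : `|2^-1 : R| < 1.
  by rewrite gtr0_norm ?invr_gt0// invf_lt1// ltr1n.
have /cvgrPdist_lt /(_ _ Re0) [N _ /(_ N (leqnn N))] := cvg_expr h.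
rewrite /= sub0r normrN => hN; exists N.
rewrite eE.
have -> : (2^-1 : R[i]) ^+ N = ((2^-1 : R) ^+ N)%:C%C.
  by rewrite rmorphXn fmorphV rmorph_nat.
by rewrite ltcR; apply: le_lt_trans hN; rewrite ler_norm.
Qed.

(** The Neumann series of 1 - c, in the guise of the fixed point of the
    contraction x |-> 1 + (1 - c) x.  The radius 1/2 makes the distances of the
    iterates a geometric series with ratio 1/2. *)
Lemma near_one_rinv (c : B) : `|cone - c| <= 2^-1 ->
  exists x, c \cdot x = cone.
Proof.
set d := cone - c => d2.
pose f (x : B) := cone + d \cdot x.
pose x n := iter n f (cone : B).
have fB y z : `|f y - f z| <= 2^-1 * `|y - z|.
  rewrite /f opprD addrACA subrr add0r -cmulBr.
  apply: le_trans (cmul_norm _ _) _.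
  by rewrite ler_wpM2r.
have h0 : 0 <= (2^-1 : R[i]) by rewrite invr_ge0.
have step n : `|x n.+1 - x n| <= 2^-1 ^+ n.+1.
  elim: n => [|n IH] /=.
    by rewrite /x /= /f cmul1r addrC addKr expr1.
  by apply: le_trans (fB _ _) _; rewrite exprS ler_wpM2l.
have dist k : forall n, `|x (n + k)%N - x n| <= 2^-1 ^+ n.
  elim: k => [|k IH] n; first by rewrite addn0 subrr normr0 exprn_ge0.
  rewrite -(subrKA (x n.+1)); apply: le_trans (ler_normD _ _) _.
  rewrite -addSnnS; apply: le_trans (lerD (IH _) (step n)) _.
  by rewrite exprS -mulrDl -[2^-1]mul1r -splitr !mul1r.
have cx : cvg (x @ \oo).
  apply: cauchy_cvg; apply: cauchy_exP => e e0.
  have [N hN] := half_expn_lt e0; exists (x N), N => // n /= Nn.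
  rewrite -ball_normE /ball_ /= distrC; apply: le_lt_trans hN.
  by rewrite -(subnKC Nn) dist.
exists (lim (x @ \oo)); set l := lim _.
have /cvgrPdist_lt xl : x @ \oo --> l by [].
have fl : l = f l.
  apply/eqP; rewrite -subr_eq0 -normr_le0.
  apply/ler_addgt0Pr => e e0; rewrite add0r.
  have e20 : 0 < e / 2 by rewrite divr_gt0.
  have [N _ hN] := xl _ e20.
  rewrite -(subrKA (x N.+1)); apply: le_trans (ler_normD _ _) _.
  rewrite (splitr e); apply: lerD; first by apply/ltW/hN => /=.
  apply: le_trans (fB (x N) l) _; rewrite distrC.
  apply: le_trans (ltW (hN N (leqnn N))).
  by rewrite ler_piMl// invf_le1// ler1n.
move: fl; rewrite /f /d cmulBl cmul1l addrCA -{1}[l]addr0 => /addrI/esym/eqP.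
by rewrite subr_eq0 => /eqP ->.
Qed.

(** The right invertible elements fill a ball around the unit, and a dense span
    meets this ball. *)
Lemma dense_lspan_rinv (S : set B) : dense (lspan S) ->
  exists n (k : 'I_n -> R[i]) (s : 'I_n -> B) x,
    (forall i, S (s i)) /\ (\sum_i k i *: s i) \cdot x = cone.
Proof.
move=> dS; have h0 : 0 < (2^-1 : R[i]) by rewrite invr_gt0.
have [||c [/= cB [n [k [s [sS ce]]]]]] := dS (ball (cone : B) 2^-1).
- by exists cone; apply: ballxx.
- exact: ball_open.
move: cB; rewrite -ball_normE /ball_ /= => /ltW /near_one_rinv [x cx].
by exists n, k, s, x; rewrite -ce.
Qed.

End NearOne.

(** * Imprimitivity bimodules *)

Lemma additive_sum (U V : zmodType) (f : U -> V) (I : Type) (r : seq I)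
    (F : I -> U) : {morph f : x y / x + y} ->
  f (\sum_(i <- r) F i) = \sum_(i <- r) f (F i).
Proof.
move=> fD; apply: (big_morph f fD).
by apply: (@addrI _ (f 0)); rewrite -fD !addr0.
Qed.

Section Bimodule.
Variables (R : realType) (B : cstarAlgType R) (M : bimod B).
Hypothesis iM : imprimitivity_bimodule M.
Implicit Types (a b u v : B) (x y z : M).

Lemma cmul_sumr I (r : seq I) (F : I -> B) b :
  b \cdot (\sum_(i <- r) F i) = \sum_(i <- r) b \cdot F i.
Proof. by apply: additive_sum => ? ?; rewrite cmulDr. Qed.

Lemma cmul_suml I (r : seq I) (F : I -> B) b :
  (\sum_(i <- r) F i) \cdot b = \sum_(i <- r) F i \cdot b.
Proof.
by apply: (@additive_sum _ _ (fun a => a \cdot b)) => ? ?; rewrite cmulDl.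
Qed.

Lemma lact_suml I (r : seq I) (F : I -> B) x :
  lact M (\sum_(i <- r) F i) x = \sum_(i <- r) lact M (F i) x.
Proof.
by apply: (@additive_sum _ _ (fun a => lact M a x)) => ? ?; rewrite lactDl.
Qed.

Lemma ract_sumr I (r : seq I) (F : I -> B) x :
  ract M x (\sum_(i <- r) F i) = \sum_(i <- r) ract M x (F i).
Proof. by apply: additive_sum => ? ?; rewrite ractDr. Qed.

Lemma ripDl x y z : rip M (x + y) z = rip M x z + rip M y z.
Proof. by rewrite -!(rip_star iM z) ripD// starD. Qed.

Lemma ripZl k x y : rip M (k *: x) y = (k^*)%C *: rip M x y.
Proof. by rewrite -!(rip_star iM y) ripZ// starZ. Qed.

Lemma rip_ractl x y b : rip M (ract M x b) y = star b \cdot rip M x y.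
Proof. by rewrite -!(rip_star iM y) rip_ract// starM. Qed.

Lemma lip_lactr x y b : lip M x (lact M b y) = lip M x y \cdot star b.
Proof. by rewrite -!(lip_star iM _ x) lip_lact// starM. Qed.

Lemma ripBl x y z : rip M (x - y) z = rip M x z - rip M y z.
Proof. by apply: (@addIr _ (rip M y z)); rewrite -ripDl !subrK. Qed.

Lemma rip_eq0 x : rip M x x = 0 -> x = 0.
Proof.
by move=> xx; apply/eqP; rewrite -normr_eq0 -sqrf_eq0 rip_norm// xx normr0.
Qed.

Lemma lip_eq0 x : lip M x x = 0 -> x = 0.
Proof.
by move=> xx; apply/eqP; rewrite -normr_eq0 -sqrf_eq0 lip_norm// xx normr0.
Qed.

Lemma rip_inj x y : (forall z, rip M x z = rip M y z) -> x = y.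
Proof.
move=> e; apply/eqP; rewrite -subr_eq0; apply/eqP/rip_eq0.
by rewrite ripBl e subrr.
Qed.

(** Fullness only says that the left inner products span a dense subspace.
    Since B is unital this space contains a right invertible element, and the
    inverse can be absorbed into the second vectors. *)
Lemma lip_frame : exists n (x y : 'I_n -> M), \sum_i lip M (x i) (y i) = cone.
Proof.
have [n [k [s [b [sS e]]]]] := dense_lspan_rinv (lip_full iM).
have /choice[p ps] : forall i, exists p : M * M, lip M p.1 p.2 = s i.
  by move=> i; have [p _ <-] := sS i; exists p.
exists n, (fun i => k i *: (p i).1), (fun i => lact M (star b) (p i).2).
rewrite -e cmul_suml; apply: eq_bigr => i _.
by rewrite lip_lactr starK lipZ// ps.
Qed.

Lemma rip_frame : exists n (x y : 'I_n -> M), \sum_i rip M (x i) (y i) = cone.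
Proof.
have [n [k [s [b [sS e]]]]] := dense_lspan_rinv (rip_full iM).
have /choice[p ps] : forall i, exists p : M * M, rip M p.1 p.2 = s i.
  by move=> i; have [p _ <-] := sS i; exists p.
exists n, (fun i => (p i).1), (fun i => ract M (k i *: (p i).2) b).
rewrite -e cmul_suml; apply: eq_bigr => i _.
by rewrite rip_ract// ripZ// ps.
Qed.

Lemma lact_inj a b : (forall x, lact M a x = lact M b x) -> a = b.
Proof.
have [n [x [y e]]] := lip_frame => ab.
rewrite -[a]cmul1r -[b]cmul1r -e !cmul_sumr; apply: eq_bigr => i _.
by rewrite -!lip_lact// ab.
Qed.

Lemma ract_inj a b : (forall x, ract M x a = ract M x b) -> a = b.
Proof.
have [n [x [y e]]] := rip_frame => ab.
rewrite -[a]cmul1l -[b]cmul1l -e !cmul_suml; apply: eq_bigr => i _.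
by rewrite -!rip_ract// ab.
Qed.

Lemma UZ_lip u x y : UZ u -> lip M (lact M u x) (lact M u y) = lip M x y.
Proof.
by move=> [_ uu uC]; rewrite lip_lact// lip_lactr cmulA uC -cmulA uu cmul1r.
Qed.

Lemma UZ_rip u x y : UZ u -> rip M (lact M u x) (lact M u y) = rip M x y.
Proof. by move=> [uu _ _]; rewrite rip_lact// -lactM// uu lact1. Qed.

Lemma UZ_lact_norm u x : UZ u -> `|lact M u x| = `|x|.
Proof.
move=> uZ; apply/eqP; rewrite -(@eqrXn2 _ 2)// ?normr_ge0//.
by rewrite rip_norm// UZ_rip// -rip_norm.
Qed.

(** The image of B is the algebra of compact operators of the right module M,
    so an operator commuting with this image comes from the center of B.  A
    frame gives a formula for the unitary.  The families f and f' allow three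
    uses: an automorphism of M (f the identity), right multiplication by a
    central unitary, and the comparison of two products on the same pairs of
    vectors, where the values of f only span M. *)
Lemma central_unitary (I : Type) (f f' : I -> M) (K : finType) (p q : K -> I) :
  \sum_k lip M (f (p k)) (f (q k)) = cone ->
  (forall i j, lip M (f' i) (f' j) = lip M (f i) (f j)) ->
  (forall i j, rip M (f' i) (f' j) = rip M (f i) (f j)) ->
  (forall b i, exists2 j, f j = lact M b (f i) & f' j = lact M b (f' i)) ->
  exists2 u, UZ u & forall i, f' i = lact M u (f i).
Proof.
move=> e fl fr fB.
have half (h h' : I -> M) : \sum_k lip M (h (p k)) (h (q k)) = cone ->
    (forall i j, lip M (h' i) (h' j) = lip M (h i) (h j)) ->
    (forall i j, rip M (h' i) (h' j) = rip M (h i) (h j)) ->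
    exists u, forall i, h' i = lact M u (h i).
  move=> e' hl hr; exists (\sum_k lip M (h' (p k)) (h (q k))) => i.
  rewrite lact_suml -[LHS](lact1 iM) -e' lact_suml; apply: eq_bigr => k _.
  by rewrite !lip_rip// -hr -!lip_rip// hl.
have [u uf] := half f f' e fl fr.
have [|||w wf] := half f' f.
- by rewrite -e; apply: eq_bigr => k _; rewrite fl.
- by move=> i j; rewrite fl.
- by move=> i j; rewrite fr.
have faithful a b : (forall i, lact M a (f i) = lact M b (f i)) -> a = b.
  move=> ab; rewrite -[a]cmul1r -[b]cmul1r -e !cmul_sumr.
  by apply: eq_bigr => i _; rewrite -!lip_lact// ab.
have wu : w \cdot u = cone.
  by apply: faithful => i; rewrite lactM// -uf -wf lact1.
have uu : u \cdot star u = cone.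
  rewrite -{1}[u]cmul1r -e cmul_sumr cmul_suml; apply: eq_bigr => k _.
  by rewrite -lip_lact// -lip_lactr -!uf fl.
have uw : star u = w by rewrite -[star u]cmul1l -wu -cmulA uu cmul1r.
exists u => //; split=> //; first by rewrite uw.
move=> b; apply: faithful => i; rewrite !lactM//.
by have [j <- fj] := fB b i; rewrite -!uf fj.
Qed.

(** Right multiplication by a central unitary of B commutes with the left
    action and preserves both inner products. *)
Lemma central_unitary_ract u : UZ u ->
  exists2 v, UZ v & forall x, lact M v x = ract M x u.
Proof.
move=> [uu uu' uC]; have [n [x [y e]]] := lip_frame.
have [|||v vZ uv] := @central_unitary M id (fun z => ract M z u) _ x y e.
- by move=> i j; rewrite lip_ract// -ractM// uu' ract1.
- by move=> i j; rewrite rip_ract// rip_ractl -cmulA -uC cmulA uu cmul1l.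
- by move=> b i; exists (lact M b i); rewrite // lractA.
- by exists v.
Qed.

End Bimodule.

Section BimoduleIso.
Variables (R : realType) (B : cstarAlgType R) (M N : bimod B) (f : M -> N).
Hypothesis iF : bimod_iso f.

Lemma bimod_isoD : {morph f : x y / x + y}.
Proof. by move=> x y; have := bimod_iso_linear iF 1 x y; rewrite !scale1r. Qed.

Lemma bimod_isoZ k x : f (k *: x) = k *: f x.
Proof.
have f0 : f 0 = 0 by apply: (@addrI _ (f 0)); rewrite -bimod_isoD !addr0.
by have := bimod_iso_linear iF k x 0; rewrite f0 !addr0.
Qed.

End BimoduleIso.

Lemma bimod_iso_id (R : realType) (B : cstarAlgType R) (M : bimod B) :
  bimod_iso (@id M).
Proof. by split=> //; exists id. Qed.

(** * The algebra of a factor system *)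

Section TotalSpace.
Variables (R : realType) (G : topGroupType).
Variable (fib : G -> completeNormedModType R[i]).

Lemma intot_fcast (g h : G) (e : g = h) (s : fib g) :
  intot (fcast e s) = intot s.
Proof. by case: h / e. Qed.

Lemma intot_inj (g : G) (s t : fib g) : intot s = intot t -> s = t.
Proof. by move/eqP; rewrite /intot eq_Tagged => /eqP. Qed.

Lemma fcastD (g h : G) (e : g = h) (s t : fib g) :
  fcast e (s + t) = fcast e s + fcast e t.
Proof. by case: h / e. Qed.

Lemma intot_tagged (x : total_space fib) : x = intot (tagged x).
Proof. by case: x. Qed.

End TotalSpace.

Section FrameInduction.
Variables (R : realType) (B : cstarAlgType R) (M : bimod B).
Hypothesis iM : imprimitivity_bimodule M.

Lemma lip_frame_eq (V : zmodType) (f f' : B -> V) :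
  {morph f : x y / x + y} -> {morph f' : x y / x + y} ->
  (forall x y : M, f (lip M x y) = f' (lip M x y)) -> f cone = f' cone.
Proof.
move=> fD fD' ff; have [n [x [y <-]]] := lip_frame iM.
by rewrite !additive_sum//; apply: eq_bigr => i _.
Qed.

Lemma lip_inj (x y : M) : (forall z, lip M x z = lip M y z) -> x = y.
Proof.
move=> e; apply/eqP; rewrite -subr_eq0; apply/eqP/(lip_eq0 iM).
apply: (@addIr _ (lip M y (x - y))).
by rewrite -lipD// subrK add0r e.
Qed.

End FrameInduction.

Section UnitInverse.
Variables (R : realType) (B : cstarAlgType R) (V : Type) (iota : B -> V).
Hypothesis ib : bijective iota.

Lemma unit_invK x : iota (unit_inv iota x) = x.
Proof.
rewrite /unit_inv; have [j _ jK] := ib.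
by apply: (@xgetPex _ 0 [set b | iota b = x]); exists (j x); rewrite /= jK.
Qed.

Lemma unit_inv_eq x b : iota b = x -> unit_inv iota x = b.
Proof. by move=> e; apply: (bij_inj ib); rewrite unit_invK e. Qed.

End UnitInverse.

Section FactorSystem.
Variables (R : realType) (G : topGroupType) (B : cstarAlgType R).
Variables (M : G -> bimod B) (iota : B -> M 1%g).
Hypothesis iM : forall g, imprimitivity_bimodule (M g).
Hypothesis iota_iso : bimod_iso (M := self_bimod B) iota.

Lemma iota_inj (a b : B) :
  intot (fib := M) (iota a) = intot (fib := M) (iota b) -> a = b.
Proof. by move/(@intot_inj _ _ M)/(bij_inj (bimod_iso_bij iota_iso)). Qed.

Lemma iota_surj g (e : g = 1%g) (x : M g) :
  exists b, intot (fib := M) x = intot (fib := M) (iota b).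
Proof.
subst g; have [j _ jK] := bimod_iso_bij iota_iso.
by exists (j x); rewrite jK.
Qed.

Lemma intot_lact g h (x : M g) (y : M h) b :
  intot (fib := M) x = intot (fib := M) y ->
  intot (fib := M) (lact (M g) b x) = intot (fib := M) (lact (M h) b y).
Proof.
by move/(congr1 (fun z : total_space M =>
  intot (fib := M) (lact (M (tag z)) b (tagged z)))).
Qed.

Lemma intot_ract g h (x : M g) (y : M h) b :
  intot (fib := M) x = intot (fib := M) y ->
  intot (fib := M) (ract (M g) x b) = intot (fib := M) (ract (M h) y b).
Proof.
by move/(congr1 (fun z : total_space M =>
  intot (fib := M) (ract (M (tag z)) (tagged z) b))).
Qed.

Lemma intot_lip g h (x y : M g) (x' y' : M h) :
  intot (fib := M) x = intot (fib := M) x' ->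
  intot (fib := M) y = intot (fib := M) y' -> lip (M g) x y = lip (M h) x' y'.
Proof.
move=> ex; have e : g = h := congr1 tag ex; subst h.
by move: ex => /(@intot_inj _ _ M) -> /(@intot_inj _ _ M) ->.
Qed.

Lemma intot_rip g h (x y : M g) (x' y' : M h) :
  intot (fib := M) x = intot (fib := M) x' ->
  intot (fib := M) y = intot (fib := M) y' -> rip (M g) x y = rip (M h) x' y'.
Proof.
move=> ex; have e : g = h := congr1 tag ex; subst h.
by move: ex => /(@intot_inj _ _ M) -> /(@intot_inj _ _ M) ->.
Qed.

Section Product.
Variable (psi : G -> bimod B -> Prop).
Variable (Psi : forall g h, M g -> M h -> M (g * h)%g).
Hypothesis fS : factor_system psi iota Psi.

(** Working in the total space makes associativity and inverses equalities
    without transport along equations in G. *)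
Definition tprod (x y : total_space M) : total_space M :=
  intot (fib := M) (Psi (tagged x) (tagged y)).

Local Notation "[ 'tot' s ]" := (intot (fib := M) s) (format "[ 'tot'  s ]").
Local Notation "x ** y" := (tprod x y) (at level 40, left associativity).
Local Notation "s ^#" := (factor_star iota Psi s) (at level 2).

Let tiso g h : tensor_iso (@Psi g h) := factor_iso fS g h.

Lemma tprodA x y z : x ** y ** z = x ** (y ** z).
Proof. exact: (factorA fS). Qed.

Lemma tprod_iota a b : [tot iota a] ** [tot iota b] = [tot iota (a \cdot b)].
Proof. exact: (factor_11 fS). Qed.

Lemma PsiDr g h (s : M g) : {morph @Psi g h s : x y / x + y}.
Proof.
by move=> x y; have := tensor_linr (tiso g h) s 1 x y; rewrite !scale1r.
Qed.

(** Left multiplication by the unit is idempotent by associativity and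
    isometric by the inner product formula for tensors, so it is the
    identity. *)
Lemma tprod_lact g b (s : M g) : [tot iota b] ** [tot s] = [tot lact (M g) b s].
Proof.
pose P (x : M g) : M g := fcast (fib := M) (mul1g g) (Psi (iota cone) x).
have PE x : [tot P x] = [tot iota cone] ** [tot x] by exact: intot_fcast.
have PP x : P (P x) = P x.
  by apply: (@intot_inj _ _ M); rewrite !PE -tprodA tprod_iota cmul1l.
have Pr x y : rip (M g) (P x) (P y) = rip (M g) x y.
  rewrite (intot_rip (PE x) (PE y)) (tensor_rip (tiso 1%g g)).
  by rewrite (bimod_iso_rip iota_iso) /= cmul1r star1 lact1.
have Ps : P s = s.
  by apply: (rip_inj (iM g)) => z; rewrite -Pr PP Pr.
have -> : iota b = lact (M 1%g) b (iota cone).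
  by rewrite -(bimod_iso_lact iota_iso) /= cmul1r.
rewrite {1}/tprod /= (tensor_lact (tiso 1%g g)); apply: intot_lact.
by rewrite -{2}Ps PE.
Qed.

Lemma tprod_ract g b (s : M g) : [tot s] ** [tot iota b] = [tot ract (M g) s b].
Proof.
pose P (x : M g) : M g := fcast (fib := M) (mulg1 g) (Psi x (iota cone)).
have PE x : [tot P x] = [tot x] ** [tot iota cone] by exact: intot_fcast.
have PP x : P (P x) = P x.
  by apply: (@intot_inj _ _ M); rewrite !PE tprodA tprod_iota cmul1l.
have Pr x y : lip (M g) (P x) (P y) = lip (M g) x y.
  rewrite (intot_lip (PE x) (PE y)) (tensor_lip (tiso g 1%g)).
  by rewrite (bimod_iso_lip iota_iso) /= cmul1l star1 ract1.
have Ps : P s = s.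
  by apply: (lip_inj (iM g)) => z; rewrite -Pr PP Pr.
have -> : iota b = ract (M 1%g) (iota cone) b.
  by rewrite -(bimod_iso_ract iota_iso) /= cmul1l.
rewrite {1}/tprod /= (tensor_ract (tiso g 1%g)); apply: intot_ract.
by rewrite -{2}Ps PE.
Qed.

(** Because the vectors are elementary tensors, an element of B is determined by
    its action on the range of Psi, with no appeal to density. *)
Lemma prod_frame g h : exists (K : finType) (p q : K -> M g * M h),
  \sum_k lip _ (Psi (p k).1 (p k).2) (Psi (q k).1 (q k).2) = cone.
Proof.
have [n [x [y xy]]] := lip_frame (iM g).
have [m [z [w zw]]] := lip_frame (iM h).
exists ('I_n * 'I_m)%type, (fun k => (x k.1, z k.2)), (fun k => (y k.1, w k.2)).
rewrite -(pair_bigA _ (fun i j =>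
  lip _ (Psi (x i) (z j)) (Psi (y i) (w j)))) /=.
rewrite -xy; apply: eq_bigr => i _.
rewrite -{2}(ract1 (iM g) (x i)) -zw ract_sumr//.
rewrite (@additive_sum _ _ (fun v => lip _ v (y i))); last first.
  by move=> ? ?; rewrite lipD.
by apply: eq_bigr => j _; rewrite (tensor_lip (tiso g h)).
Qed.

Lemma prod_lact_inj g h (a b : B) :
  (forall (s : M g) (t : M h), lact _ a (Psi s t) = lact _ b (Psi s t)) ->
  a = b.
Proof.
have [K [p [q e]]] := prod_frame g h => ab.
rewrite -[a]cmul1r -[b]cmul1r -e !cmul_sumr; apply: eq_bigr => k _.
by rewrite -!lip_lact// ab.
Qed.

Lemma prod_left_inj g h (x y : M g) :
  (forall t : M h, Psi x t = Psi y t) -> x = y.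
Proof.
move=> xy; apply: (lip_inj (iM g)) => z.
have e := @lip_frame_eq _ _ _ (iM h) _
  (fun b => lip _ (ract _ x b) z) (fun b => lip _ (ract _ y b) z).
rewrite -(ract1 (iM g) x) -(ract1 (iM g) y); apply: e.
- by move=> a b; rewrite ractDr// lipD.
- by move=> a b; rewrite ractDr// lipD.
by move=> t t'; rewrite -!(tensor_lip (tiso g h)) xy.
Qed.

Lemma prod_rip_inj g h (x y : M (g * h)%g) :
  (forall (s : M g) (t : M h), rip _ x (Psi s t) = rip _ y (Psi s t)) -> x = y.
Proof.
move=> xy; apply/eqP; rewrite -subr_eq0; apply/eqP/(lip_eq0 (iM _)).
apply: (@prod_lact_inj g h) => s t; rewrite lip_rip// ripBl// xy subrr.
have r0 z : ract (M (g * h)%g) z 0 = 0.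
  by apply: (@addrI _ (ract _ z 0)); rewrite -ractDr// !addr0.
have l0 z : lact (M (g * h)%g) 0 z = 0.
  by apply: (@addrI _ (lact _ 0 z)); rewrite -lactDl// !addr0.
by rewrite r0 l0.
Qed.

Lemma factor_lambdaE g (s : M g) (t : M (g^-1)%g) :
  [tot iota (factor_lambda iota Psi s t)] = [tot s] ** [tot t].
Proof.
rewrite /factor_lambda unit_invK ?intot_fcast//.
exact: bimod_iso_bij iota_iso.
Qed.

Lemma factor_lambdaD g (s : M g) :
  {morph factor_lambda iota Psi s : x y / x + y >-> (x : B) + y}.
Proof.
move=> x y; apply: iota_inj; rewrite (bimod_isoD iota_iso).
have iE z : iota (factor_lambda iota Psi s z) =
    fcast (fib := M) (mulgV g) (Psi s z).
  by rewrite unit_invK//; apply: bimod_iso_bij iota_iso.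
by rewrite !iE PsiDr fcastD.
Qed.

Lemma factor_lambda_ract g (s : M g) t b :
  factor_lambda iota Psi s (ract _ t b) =
  (factor_lambda iota Psi s t : B) \cdot b.
Proof.
apply: iota_inj; rewrite factor_lambdaE -tprod_ract -tprodA -factor_lambdaE.
by rewrite tprod_iota.
Qed.

(** A bounded right-B-linear functional on M (g^-1) is an inner product with a
    vector; here the frame writes this vector down. *)
Lemma factor_lambda_adjoint g (s : M g) :
  exists T : self_bimod B -> M (g^-1)%g, adjoint (factor_lambda iota Psi s) T.
Proof.
have [n [x [y e]]] := lip_frame (iM (g^-1)%g).
pose z := \sum_i ract _ (y i) (star (factor_lambda iota Psi s (x i) : B)).
exists (fun b => ract _ z b) => m b /=; rewrite rip_ract//; congr (_ \cdot _).
rewrite -(rip_star (iM _)); congr star.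
rewrite -{1}(lact1 (iM _) m) -e lact_suml//.
rewrite (additive_sum _ _ (factor_lambdaD s)).
rewrite /z (@additive_sum _ _ (fun v => rip _ v m)); last first.
  by move=> ? ?; rewrite ripDl.
apply: eq_bigr => i _; rewrite lip_rip// factor_lambda_ract rip_ractl//.
by rewrite starK.
Qed.

Lemma factor_star_spec g (s : M g) (t : M (g^-1)%g) :
  [tot s] ** [tot t] = [tot iota (rip _ s^# t)].
Proof.
have [T aT] := factor_lambda_adjoint s.
rewrite /factor_star; case: xgetP => [x _ [T' aT' ->]|/(_ (T (cone : B)))[]].
  rewrite -factor_lambdaE -(rip_star (iM _)) -aT' /= starM starK star1.
  by rewrite cmul1l.
by exists T.
Qed.

Lemma factor_starE g h (e : h = (g^-1)%g) (s : M g) (x t : M h) :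
  [tot x] = [tot s^#] -> [tot s] ** [tot t] = [tot iota (rip _ x t)].
Proof.
by subst h => /(@intot_inj _ _ M) ->; rewrite factor_star_spec.
Qed.

Lemma factor_star_uniq g h (e : h = (g^-1)%g) (s : M g) (x : M h) :
  (forall t : M h, [tot s] ** [tot t] = [tot iota (rip _ x t)]) ->
  [tot s^#] = [tot x].
Proof.
subst h => sx; congr intot; apply: (rip_inj (iM _)) => t; apply: iota_inj.
by rewrite -sx factor_star_spec.
Qed.

(** The left inner product of Psi s t and Psi s' t', two vectors of the unit
    fiber, can be expanded through the tensor formula or through the definition
    of the star; summing over a frame of t and t' compares the results. *)
Lemma rip_factor_star g (s s' : M g) : rip _ s^# s'^# = lip _ s s'.
Proof.
have h := @lip_frame_eq _ _ _ (iM (g^-1)%g) _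
  (fun b => rip _ s^# (lact _ b s'^#)) (fun b => lip _ (ract _ s b) s').
rewrite -[s'^#](lact1 (iM _)) -[s in RHS](ract1 (iM _)); apply: h.
- by move=> a b; rewrite lactDl// ripD.
- by move=> a b; rewrite ractDr// lipD.
move=> t t'; rewrite -(tensor_lip (tiso _ _)).
rewrite (intot_lip (factor_star_spec s t) (factor_star_spec s' t')).
by rewrite (bimod_iso_lip iota_iso) /= rip_star// lip_rip// rip_ract.
Qed.

(** Multiplying by an arbitrary x on the left turns the claim, by associativity,
    into the compatibility of the two inner products of a bimodule. *)
Lemma tprod_star g (s r : M g) : [tot s^#] ** [tot r] = [tot iota (rip _ s r)].
Proof.
have [c sc] := iota_surj (mulVg g) (Psi s^# r).
rewrite {1}/tprod /= sc; congr [tot iota _].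
apply: (ract_inj (iM g)) => x; apply: (@intot_inj _ _ M).
rewrite -tprod_ract -sc -[X in _ ** X]/([tot s^#] ** [tot r]) -tprodA.
by rewrite factor_star_spec tprod_lact rip_factor_star lip_rip.
Qed.

Lemma tprod_starr g (s t : M g) : [tot s] ** [tot t^#] = [tot iota (lip _ s t)].
Proof. by rewrite factor_star_spec rip_factor_star. Qed.

Lemma factor_starK g (s : M g) : [tot (s^#)^#] = [tot s].
Proof. by apply: factor_star_uniq; [rewrite invgK|exact: tprod_star]. Qed.

(** Both sides have the same inner products with elementary tensors Psi a b,
    by associativity of the four-fold product of s, t, a and b. *)
Lemma factor_starM g h (s : M g) (t : M h) :
  [tot (Psi s t)^#] = [tot t^#] ** [tot s^#].
Proof.
pose z := fcast (fib := M) (invgM g h) (Psi s t)^#.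
have zE : [tot z] = [tot (Psi s t)^#] by exact: intot_fcast.
rewrite -zE; congr [tot _]; apply: prod_rip_inj => a b; apply: iota_inj.
rewrite -(@factor_starE _ _ (esym (invgM g h)) (Psi s t) z (Psi a b) zE).
rewrite -[[tot Psi s t]]/([tot s] ** [tot t]).
rewrite -[[tot Psi a b]]/([tot a] ** [tot b]) tprodA -(tprodA [tot t]).
rewrite factor_star_spec tprod_lact factor_star_spec.
by rewrite (tensor_rip (tiso _ _)).
Qed.

Lemma factor_star_iota b : [tot (iota b)^#] = [tot iota (star b)].
Proof.
apply: factor_star_uniq => [|t]; first by rewrite invg1.
have [c tc] := iota_surj erefl t; have {tc}-> := @intot_inj _ _ M _ _ _ tc.
by rewrite tprod_iota (bimod_iso_rip iota_iso) /= starK.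
Qed.

(** The star of s depends on the functional Psi s only, and does so
    antilinearly; this covers sums and multiples together. *)
Lemma factor_star_antilinear g (s t r : M g) (k : R[i]) :
  (forall x : M (g^-1)%g, Psi r x = k *: Psi s x + Psi t x) ->
  r^# = (k^*)%C *: s^# + t^#.
Proof.
move=> rst; apply: (@intot_inj _ _ M); apply: factor_star_uniq => // x.
rewrite ripDl// ripZl// conjcK.
have uE y : Psi y x = fcast (fib := M) (esym (mulgV g)) (iota (rip _ y^# x)).
  by apply: (@intot_inj _ _ M); rewrite intot_fcast -factor_star_spec.
rewrite {1}/tprod /= rst !uE.
move: (rip _ _ _) (rip _ _ _) => a b.
case: _ / (esym _) => /=.
by rewrite (bimod_iso_linear iota_iso).
Qed.

Lemma factor_starD g (s t : M g) : (s + t)^# = s^# + t^#.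
Proof.
rewrite (@factor_star_antilinear _ s t _ 1) ?conjc1 ?scale1r// => x.
by have := tensor_linl (tiso _ _) x 1 s t; rewrite !scale1r.
Qed.

Lemma factor_starZ g k (s : M g) : (k *: s)^# = (k^*)%C *: s^#.
Proof.
have s0 : (0 : M g)^# = 0.
  by apply: (@addrI _ (0 : M g)^#); rewrite -factor_starD !addr0.
rewrite (@factor_star_antilinear _ s 0 _ k) ?s0 ?addr0// => x.
by have := tensor_linl (tiso _ _) x k s 0; rewrite addr0.
Qed.

End Product.
End FactorSystem.

(** * The action of the group on central unitaries *)

Section PicardAction.
Variables (R : realType) (G : topGroupType) (B : cstarAlgType R).
Variable psi : G -> bimod B -> Prop.
Hypothesis psi_pic : forall g, is_pic (psi g).
Implicit Types (u v : B).

Lemma psi_imprimitivity g (N : bimod B) : psi g N -> imprimitivity_bimodule N.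
Proof. by have [M _ ->] := psi_pic g => -[]. Qed.

Lemma picard_actP g u : UZ u -> UZ (picard_act psi g u) /\
  forall N : bimod B, psi g N ->
  forall x : N, lact N (picard_act psi g u) x = ract N x u.
Proof.
move=> uZ; rewrite /picard_act.
apply: (@xgetPex _ cone [set v | UZ v /\ forall N : bimod B, psi g N ->
  forall x : N, lact N v x = ract N x u]) => /=.
have [M iM ->] := psi_pic g.
have [v vZ uv] := central_unitary_ract iM uZ.
exists v; split=> // N [_ [f fiso]] x.
have [j _ jK] := bimod_iso_bij fiso; rewrite -(jK x).
by rewrite -(bimod_iso_lact fiso) uv (bimod_iso_ract fiso).
Qed.

Lemma picard_act_UZ g u : UZ u -> UZ (picard_act psi g u).
Proof. by case/(picard_actP g). Qed.

Lemma picard_act_lact g u (N : bimod B) (x : N) : UZ u -> psi g N ->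
  lact N (picard_act psi g u) x = ract N x u.
Proof. by case/(picard_actP g) => _ h /h. Qed.

Lemma picard_act_uniq g u v (N : bimod B) : UZ u -> psi g N ->
  (forall x : N, lact N v x = ract N x u) -> picard_act psi g u = v.
Proof.
move=> uZ gN vu; apply: (lact_inj (psi_imprimitivity gN)) => x.
by rewrite vu picard_act_lact.
Qed.

Lemma picard_actM g u v : UZ u -> UZ v ->
  picard_act psi g (u \cdot v) = picard_act psi g u \cdot picard_act psi g v.
Proof.
move=> uZ vZ; have [M iM gM] := psi_pic g.
have pM : psi g M by rewrite gM; split=> //; exists id; exact: bimod_iso_id.
apply: (picard_act_uniq (UZ_mul uZ vZ) pM) => x.
rewrite lactM// !picard_act_lact// -ractM//.
by case: uZ => _ _ ->.
Qed.

Lemma picard_act1 g : picard_act psi g cone = cone.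
Proof.
have [M iM gM] := psi_pic g.
have pM : psi g M by rewrite gM; split=> //; exists id; exact: bimod_iso_id.
apply: (picard_act_uniq (UZ1 B) pM) => x.
by rewrite lact1// ract1.
Qed.

Lemma picard_act_star g u : UZ u ->
  picard_act psi g (star u) = star (picard_act psi g u).
Proof.
move=> uZ; have [vv _ _] := picard_act_UZ g uZ.
have [_ uu _] := uZ.
rewrite -[LHS]cmul1l -vv -cmulA -picard_actM//; last exact: UZ_star.
by rewrite uu picard_act1 cmul1r.
Qed.

End PicardAction.

(** * The Fell bundle of a factor system *)

Section FactorBundle.
Variables (R : realType) (G : topGroupType) (B : cstarAlgType R).
Variables (M : G -> bimod B) (iota : B -> M 1%g).
Variable (psi : G -> bimod B -> Prop).
Hypothesis psi_pic : forall g, is_pic (psi g).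
Variable (Psi : forall g h, M g -> M h -> M (g * h)%g).
Hypothesis fS : factor_system psi iota Psi.
Variable tau : topology_on (total_space M).

Let iM g : imprimitivity_bimodule (M g).
Proof. exact: (psi_imprimitivity psi_pic (factor_psi fS g)). Qed.

Let iota_iso := factor_unit fS.

Lemma bimod_eta (N : bimod B) l r li ri :
  l = lact N -> r = ract N -> li = lip N -> ri = rip N ->
  @Bimod R B N l r li ri = N.
Proof. by case: N l r li ri => ? ? ? ? ? ? ? ? ? /= -> -> -> ->. Qed.

(** Since the bimodule structure of a fiber is recovered from product and star,
    every factor system on the bimodules M has the Picard homomorphism of M. *)
Lemma fiber_bimod_factor_bundle g :
  fiber_bimod (factor_bundle iota tau Psi) g = M g.
Proof.
apply: bimod_eta; apply/funext => x; apply/funext => y /=.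
- apply: (@intot_inj _ _ M); rewrite intot_fcast.
  exact: (tprod_lact iM iota_iso fS).
- apply: (@intot_inj _ _ M); rewrite intot_fcast.
  exact: (tprod_ract iM iota_iso fS).
- apply: unit_inv_eq; first exact: bimod_iso_bij iota_iso.
  apply: (@intot_inj _ _ M); rewrite intot_fcast.
  transitivity (tprod Psi (intot (fib := M) x)
    (intot (fib := M) (factor_star iota Psi y))) => //.
  rewrite (factor_star_spec iM iota_iso fS).
  by rewrite (rip_factor_star iM iota_iso fS).
- apply: unit_inv_eq; first exact: bimod_iso_bij iota_iso.
  apply: (@intot_inj _ _ M); rewrite intot_fcast.
  exact/esym/(tprod_star iM iota_iso fS).
Qed.

Lemma iota_norm b : `|iota b| = `|b|.
Proof.
apply/eqP; rewrite -(@eqrXn2 _ 2)// ?normr_ge0//.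
by rewrite (rip_norm (iM 1%g)) (bimod_iso_rip iota_iso) cstar_identity.
Qed.

(** The algebraic axioms, including positivity and the C*-identity, are the
    properties of the star of a factor system.  A twist changes neither the
    norms of products nor the topology, which supplies the hypotheses below. *)
Lemma saturated_factor_bundle : banach_bundle tau ->
  (forall g h (s : M g) (t : M h), `|Psi s t| <= `|s| * `|t|) ->
  continuous (fun p : with_top tau * with_top tau =>
    tprod Psi p.1 p.2 : with_top tau) ->
  continuous (fun s : with_top tau =>
    intot (fib := M) (factor_star iota Psi (tagged s)) : with_top tau) ->
  saturated_fell_bundle (factor_bundle iota tau Psi).
Proof.
move=> bb normP contP contS.
split; last by move=> g h; exact: tensor_dense (factor_iso fS g h).
split=> //=.
- by move=> r s t; exact/esym/(factorA fS).
- by move=> g h t; exact: tensor_linl (factor_iso fS g h) t.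
- by move=> g h s; exact: tensor_linr (factor_iso fS g h) s.
- exact: (factor_starD iM iota_iso fS).
- by move=> g k s; exact: (factor_starZ iM iota_iso fS).
- by move=> s t; exact: (factor_starM iM iota_iso fS).
- move=> s; rewrite [RHS]intot_tagged.
  exact: (factor_starK iM iota_iso fS).
- move=> g s; rewrite (rip_norm (iM g)) -iota_norm.
  by have /(congr1 (fun x : total_space M => `|tagged x|)) :=
    tprod_star iM iota_iso fS s s.
- exact: bimod_iso_linear iota_iso.
- exact: bimod_iso_bij iota_iso.
- exact: iota_norm.
- by move=> a b; exact/esym/(factor_11 fS).
- by move=> b; exact/esym/(factor_star_iota iM iota_iso fS).
- move=> s; exists (rip _ (tagged s) (tagged s)); first exact: rip_ge0.
  exact: (tprod_star iM iota_iso fS).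
Qed.

End FactorBundle.

(** * Twisting a factor system by a cocycle *)

Section Twist.
Variables (R : realType) (G : topGroupType) (B : cstarAlgType R).
Variables (M : G -> bimod B) (iota : B -> M 1%g).
Variable (psi : G -> bimod B -> Prop).
Hypothesis psi_pic : forall g, is_pic (psi g).
Variable (Psi : forall g h, M g -> M h -> M (g * h)%g).
Hypothesis fS : factor_system psi iota Psi.
Variable omega : G -> G -> B.
Hypothesis cO : cocycle2 psi omega.

Let iM g : imprimitivity_bimodule (M g).
Proof. exact: (psi_imprimitivity psi_pic (factor_psi fS g)). Qed.

Let iota_iso := factor_unit fS.

Lemma twist_tensor_iso g h : tensor_iso (@twist R G B M omega Psi g h).
Proof.
have tiso := factor_iso fS g h.
have [oo oo' oC] := cocycle2_UZ cO g h.
split=> [n k x y|m k x y|m b n|b m n|m n b|m n m' n'|m n m' n'|];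
  rewrite /twist.
- by rewrite (tensor_linl tiso) lactDr// lactZr.
- by rewrite (tensor_linr tiso) lactDr// lactZr.
- by rewrite (tensor_balanced tiso).
- by rewrite (tensor_lact tiso) -!lactM// oC.
- by rewrite (tensor_ract tiso) lractA.
- by rewrite UZ_lip// (tensor_lip tiso).
- by rewrite UZ_rip// (tensor_rip tiso).
(* omega g h can be moved from the product to its first factor. *)
suff -> : [set lact (M (g * h)%g) (omega g h) (Psi p.1 p.2) |
    p in [set: M g * M h]] = [set Psi p.1 p.2 | p in [set: M g * M h]].
  exact: tensor_dense tiso.
apply/seteqP; split=> _ [[m n] _ <-] /=.
  by exists (lact _ (omega g h) m, n); rewrite //= (tensor_lact tiso).
exists (lact _ (star (omega g h)) m, n) => //=.
by rewrite (tensor_lact tiso) -lactM// oo' lact1.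
Qed.

Lemma tprod_twist (x y : total_space M) : tprod (twist omega Psi) x y =
  tprod Psi (intot (fib := M) (iota (omega (tag x) (tag y)))) (tprod Psi x y).
Proof. exact/esym/(tprod_lact iM iota_iso fS). Qed.

Lemma twist_factor_system : factor_system psi iota (twist omega Psi).
Proof.
split; [exact: factor_psi fS|exact: iota_iso|exact: twist_tensor_iso| |].
  by move=> a b; rewrite /twist (cocycle2_1l cO) lact1// (factor_11 fS).
move=> g h k r s t; rewrite /twist.
(* omega h k has to pass r, which replaces it by its image under psi g. *)
have tiso := factor_iso fS.
rewrite (tensor_lact (tiso _ _)) -lactM//.
rewrite -(tensor_balanced (tiso _ _)).
rewrite -(picard_act_lact psi_pic _ _ (factor_psi fS g)).
  rewrite (tensor_lact (tiso _ _)) -lactM//.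
  have [_ _ oC] := cocycle2_UZ cO g (h * k)%g.
  rewrite oC (cocycle2_eq cO); exact/intot_lact/(factorA fS).
exact: (cocycle2_UZ cO).
Qed.

Lemma factor_star_twist g (s : M g) :
  intot (fib := M) (factor_star iota (twist omega Psi) s) =
  tprod Psi (intot (fib := M) (factor_star iota Psi s))
    (intot (fib := M) (iota (star (omega g g^-1%g)))).
Proof.
rewrite (tprod_ract iM iota_iso fS).
apply: (factor_star_uniq iM iota_iso twist_factor_system) => // t.
rewrite tprod_twist (factor_star_spec iM iota_iso fS) (tprod_iota fS).
by rewrite rip_ractl// starK.
Qed.

Lemma twist_norm g h (s : M g) (t : M h) :
  `|twist omega Psi s t| = `|Psi s t|.
Proof. by rewrite /twist UZ_lact_norm//; exact: (cocycle2_UZ cO). Qed.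

End Twist.

(** * The topology of a bundle near its unit fiber *)

Section RealNorm.
Variables (R : realType) (V : normedModType R[i]).

Lemma ltr_rnorm (x : V) (r : R) : (`|x| < r%:C%C) = (rnorm x < r).
Proof.
have -> : `|x| = (rnorm x)%:C%C by rewrite RRe_real// ger0_real.
by rewrite ltcR.
Qed.

Lemma rnorm_ge0 (x : V) : 0 <= rnorm x.
Proof. by have := normr_ge0 x; rewrite lecE => /andP[]. Qed.

Lemma gt0_Re (e : R[i]) : 0 < e ->
  0 < complex.Re e /\ e = (complex.Re e)%:C%C.
Proof.
move=> e0; have eE : e = (complex.Re e)%:C%C.
  by rewrite RRe_real// ger0_real// ltW.
by split=> //; rewrite -ltcR -eE.
Qed.

End RealNorm.

Section UnitFiberTopology.
Variables (R : realType) (G : topGroupType) (B : cstarAlgType R).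
Variables (M : G -> bimod B) (iota : B -> M 1%g).
Variable tau : topology_on (total_space M).
Hypothesis bb : banach_bundle tau.
Hypothesis iota_linear : linear iota.
Hypothesis iota_isom : forall b, `|iota b| = `|b|.

Let T := with_top tau.
Let emb (b : B) : T := intot (fib := M) (iota b).

Let iota_sub a b : iota (a - b) = iota a - iota b.
Proof. by rewrite addrC -scaleN1r iota_linear scaleN1r addrC. Qed.

Lemma cvg_tadd (Y : Type) (F : set_system Y) (FF : Filter F) (f h : Y -> T)
    (s t : T) : (forall y, tag (f y) = tag (h y)) -> tag s = tag t ->
  f @ F --> s -> h @ F --> t ->
  (fun y => tadd (f y) (h y) : T) @ F --> (tadd s t : T).
Proof.
move=> fh st fs ht.
have /subspace_continuousP add := tadd_continuous bb.
have {}add := add (s, t) st.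
have fht : (fun y => (f y, h y)) @ F --> (s, t) by exact: (cvg_pair fs ht).
move=> U /add /fht; rewrite /nbhs /= => h'.
by apply: filterS h' => y; apply; exact: fh.
Qed.

Lemma cvg_zero (Y : Type) (F : set_system Y) (FF : ProperFilter F) (f : Y -> T)
    (g : G) : (fun y => tnorm (f y)) @ F --> (0 : R) ->
  (fun y => tag (f y)) @ F --> g -> f @ F --> (intot (fib := M) (0 : M g) : T).
Proof. exact: (@zero_limit _ _ _ _ bb (f @ F)). Qed.

(** At 0 this is the axiom on nets with norms tending to 0; translation by a
    fixed vector of the unit fiber carries it to the other points. *)
Lemma emb_continuous : continuous emb.
Proof.
move=> b0.
have d0 : (fun b => emb (b - b0)) @ b0 --> (intot (fib := M) (0 : M 1%g) : T).
  apply: (@cvg_zero _ _ _ _ 1%g); last first.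
    by apply: (@cvg_cst G).
  apply/cvgrPdist_lt => e e0.
  have ec0 : (0 : R[i]) < e%:C%C by rewrite ltcR.
  have /cvgrPdist_lt /(_ _ ec0) := @cvg_id _ (nbhs b0).
  apply: filterS => b; rewrite distrC ltr_rnorm sub0r normrN /tnorm => bb0.
  rewrite (_ : rnorm _ = rnorm (b - b0)) ?ger0_norm ?rnorm_ge0//.
  by rewrite /rnorm iota_isom.
have := @cvg_tadd B (nbhs b0) _ (fun _ => emb b0) (fun b => emb (b - b0))
  (emb b0) (intot (fib := M) (0 : M 1%g)) (fun _ => erefl) erefl
  (cvg_cst _) d0.
have -> : (fun b => tadd (emb b0) (emb (b - b0)) : T) = emb.
  apply/funext => b.
  by rewrite /tadd /= tagged_asE iota_sub addrC subrK.
rewrite /tadd /= tagged_asE addr0.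
exact.
Qed.

(** Conversely, the bundle topology controls the norm on the unit fiber:
    subtract iota a and use that the norm is continuous on the total space. *)
Lemma emb_separated (a : B) (e : R[i]) : 0 < e ->
  nbhs (emb a) [set s : T | forall b, s = emb b -> `|b - a| < e].
Proof.
move=> e0.
have [Re0 eE] := gt0_Re e0.
pose na : T := intot (fib := M) (- iota a).
have := @tnorm_continuous _ _ _ _ bb (tadd (emb a) na).
have /subspace_continuousP add := tadd_continuous bb.
have {}add := add (emb a, na) erefl.
move/cvgrPdist_lt/(_ _ Re0)/add.
rewrite /tadd /= tagged_asE subrr => -[[U V] /= [aU naV] UV].
apply: filterS aU => s sU b sE.
have := UV (s, na) (conj sU (nbhs_singleton naV)).
rewrite sE => /(_ erefl).
rewrite /from_subspace /tadd /= tagged_asE -iota_sub /tnorm /=.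
rewrite {1}/rnorm normr0 sub0r normrN ger0_norm ?rnorm_ge0//.
by rewrite /rnorm iota_isom -/(rnorm (b - a)) -ltr_rnorm -eE.
Qed.

Lemma fiber_lift (s : T) (U : set T) : nbhs s U ->
  \forall g \near tag s, exists2 s' : T, U s' & tag s' = g.
Proof.
rewrite nbhsE => -[V [Vo Vs] VU].
have /open_nbhs_nbhs : open_nbhs (tag s) [set tag x | x in V].
  by split; [exact: (Defs.proj_open bb)|exists s].
by apply: filterS => g [s' Vs' <-]; exists s' => //; exact: VU.
Qed.

Section UnitaryFamily.
Variables (X : topologicalType) (om : X -> B).
Hypothesis omZ : forall x, UZ (om x).

(** The elements of B over which om is seen to be continuous at x0: near x0,
    approximations n of a exist such that om x \cdot n approximates
    om x0 \cdot a.  They are closed under sums, so a frame reduces the unit to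
    inner products; and if the unit is one of them, then om is continuous at x0
    because multiplication by om x does not increase norms. *)
Definition probe (x0 : X) (a : B) : Prop := forall e : R[i], 0 < e ->
  \forall x \near x0, exists n, `|n - a| < e /\
    `|om x \cdot n - om x0 \cdot a| < e.

Lemma probe_sum (x0 : X) (K : finType) (a : K -> B) :
  (forall k, probe x0 (a k)) -> probe x0 (\sum_k a k).
Proof.
move=> pa; apply: (big_ind (probe x0)) => //.
- move=> e e0; apply: nearW => x; exists 0.
  have r0 b : b \cdot (0 : B) = 0.
    by apply: (@addrI _ (b \cdot 0)); rewrite -cmulDr !addr0.
  by rewrite !r0 subrr normr0.
- move=> b c pb pc e e0; have e20 : 0 < e / 2 by rewrite divr_gt0.
  apply: filterS2 (pb _ e20) (pc _ e20) => x [n [n1 n2]] [m [m1 m2]].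
  have split4 (u v w z : B) : u + v - (w + z) = (u - w) + (v - z).
    by rewrite opprD addrACA.
  exists (n + m); rewrite !cmulDr !split4 (splitr e).
  by split; apply: le_lt_trans (ler_normD _ _) _; apply: ltrD.
Qed.

Lemma probe_continuous (x0 : X) : probe x0 cone -> om @ x0 --> om x0.
Proof.
move=> p1; apply/cvgrPdist_lt => e e0.
have e20 : 0 < e / 2 by rewrite divr_gt0.
apply: filterS (p1 _ e20) => x [n [n1 n2]].
rewrite distrC -[om x]cmul1r -(subrKA (om x \cdot n)) -cmulBr (splitr e).
apply: le_lt_trans (ler_normD _ _) _; apply: ltrD; last first.
  by rewrite -[om x0]cmul1r.
by apply: le_lt_trans (UZ_norm_le _ (omZ x)) _; rewrite distrC.
Qed.

(** In the applications Y is a power of the total space, y0 consists of the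
    vectors of an inner product a, and D says that the vectors lie in the right
    fibers.  The lifting hypothesis comes from the openness of the bundle
    projection, which here plays the part of local continuous sections. *)
Lemma probe_lift (Y : topologicalType) (D : X -> set Y) (f f' : Y -> T)
    (x0 : X) (y0 : Y) (a : B) :
  (forall U, nbhs y0 U -> \forall x \near x0, exists2 y, U y & D x y) ->
  f @ y0 --> f y0 -> f' @ y0 --> f' y0 ->
  (forall x y, D x y -> exists2 b, f y = emb b & f' y = emb (om x \cdot b)) ->
  f y0 = emb a -> f' y0 = emb (om x0 \cdot a) -> probe x0 a.
Proof.
move=> lift fc fc' fD fa fa' e e0.
rewrite fa in fc; rewrite fa' in fc'.
have U1 : nbhs y0 (f @^-1` _) := fc _ (emb_separated a e0).
have U2 : nbhs y0 (f' @^-1` _) := fc' _ (emb_separated (om x0 \cdot a) e0).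
apply: filterS (lift _ (filterI U1 U2)) => x [y [Uf Uf'] /fD[b fb fb']].
by exists b; split; [exact: Uf|exact: Uf'].
Qed.

End UnitaryFamily.
End UnitFiberTopology.

(** * Continuity of twisted products *)

Section UnitaryContinuity.
Variables (R : realType) (B : cstarAlgType R) (X : topologicalType).

Lemma star_continuous (f : X -> B) : continuous f ->
  continuous (fun x => star (f x)).
Proof.
move=> fc x; have /cvgrPdist_lt h := fc x.
apply/cvgrPdist_lt => e /h; apply: filterS => y.
have -> : star (f x) - star (f y) = star (f x - f y).
  by apply/eqP; rewrite subr_eq -starD subrK.
by rewrite norm_star.
Qed.

Lemma UZ_mul_continuous (f h : X -> B) :
  (forall x, UZ (f x)) -> (forall x, UZ (h x)) ->
  continuous f -> continuous h -> continuous (fun x => f x \cdot h x).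
Proof.
move=> fZ hZ fc hc x; have /cvgrPdist_lt fe := fc x.
have /cvgrPdist_lt he := hc x.
apply/cvgrPdist_lt => e e0; have e20 : 0 < e / 2 by rewrite divr_gt0.
apply: filterS2 (fe _ e20) (he _ e20) => y fy hy.
have -> : f x \cdot h x - f y \cdot h y =
    f x \cdot (h x - h y) + h y \cdot (f x - f y).
  rewrite !cmulBr; have [_ _ hC] := hZ y.
  by rewrite !hC addrA subrK.
rewrite (splitr e); apply: le_lt_trans (ler_normD _ _) _.
by apply: ltrD; apply: le_lt_trans (UZ_norm_le _ _) _.
Qed.

End UnitaryContinuity.

Lemma ext_continuous (X Y : topologicalType) (f h : X -> Y) :
  (forall x, h x = f x) -> continuous f -> continuous h.
Proof. by move/funext ->. Qed.

Lemma pair_continuous (X Y Z : topologicalType) (f : X -> Y) (h : X -> Z) :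
  continuous f -> continuous h -> continuous (fun x => (f x, h x)).
Proof. by move=> fc hc x; exact: cvg_pair (fc x) (hc x). Qed.

Section FactorTopology.
Variables (R : realType) (G : topGroupType) (B : cstarAlgType R).
Variables (M : G -> bimod B) (iota : B -> M 1%g).
Variable (psi : G -> bimod B -> Prop).
Hypothesis psi_pic : forall g, is_pic (psi g).
Variable tau : topology_on (total_space M).
Variable (Psi : forall g h, M g -> M h -> M (g * h)%g).
Hypothesis fS : factor_system psi iota Psi.
Hypothesis fB : saturated_fell_bundle (factor_bundle iota tau Psi).

Let iM g : imprimitivity_bimodule (M g).
Proof. exact: (psi_imprimitivity psi_pic (factor_psi fS g)). Qed.

Let iota_iso := factor_unit fS.
Let bb : banach_bundle tau := fell_banach fB.1.
Let T := with_top tau.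
Let emb (b : B) : T := intot (fib := M) (iota b).
Let tstarP (s : T) : T := intot (fib := M) (factor_star iota Psi (tagged s)).

Let embC : continuous emb.
Proof.
apply: (emb_continuous bb); first exact: bimod_iso_linear iota_iso.
exact: iota_norm psi_pic _ fS.
Qed.

Lemma tprod_continuous (Y : topologicalType) (f h : Y -> T) (y : Y) :
  f @ y --> f y -> h @ y --> h y ->
  (fun y => tprod Psi (f y) (h y) : T) @ y --> (tprod Psi (f y) (h y) : T).
Proof.
move=> fc hc; apply: (@cvg_comp _ _ _ (fun y => (f y, h y))
  (fun p : T * T => tprod Psi p.1 p.2 : T) _ (nbhs (f y, h y))).
  exact: cvg_pair fc hc.
exact: (@fmul_continuous _ _ _ _ fB.1 (f y, h y)).
Qed.

Lemma tstarP_continuous (Y : topologicalType) (f : Y -> T) (y : Y) :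
  f @ y --> f y -> (fun y => tstarP (f y)) @ y --> tstarP (f y).
Proof.
move=> fc; apply: (cvg_comp _ _ fc).
exact: (@fstar_continuous _ _ _ _ fB.1 (f y)).
Qed.

Lemma tag_continuous : continuous (fun s : T => tag s).
Proof. exact: (Defs.proj_continuous bb). Qed.

(** Multiplication by omega is multiplication by a continuous family of vectors
    of the unit fiber, so the continuity of the twisted operations is that of
    the original ones. *)
Lemma twist_saturated omega : cocycle2 psi omega ->
  saturated_fell_bundle (factor_bundle iota tau (twist omega Psi)).
Proof.
move=> cO; apply: (saturated_factor_bundle psi_pic) => //.
- exact: twist_factor_system.
- move=> g h s t; rewrite (twist_norm psi_pic fS cO).
  exact: (fmul_norm fB.1).
- apply: (@ext_continuous _ T (fun p : T * T => tprod Psi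
    (emb (omega (tag p.1) (tag p.2))) (tprod Psi p.1 p.2))) => [p|p].
    by rewrite (tprod_twist psi_pic fS).
  apply: tprod_continuous; last by apply: (@fmul_continuous _ _ _ _ fB.1 p).
  apply: (continuous_comp _ (@embC _)).
  apply: (@continuous_comp _ _ _ (fun p : T * T => (tag p.1, tag p.2))
    (fun p => omega p.1 p.2)); last exact: cocycle2_continuous cO _.
  apply: pair_continuous => q.
    by apply: (@continuous_comp _ _ _ fst (fun s : T => tag s));
      [exact: cvg_fst|exact: tag_continuous].
  by apply: (@continuous_comp _ _ _ snd (fun s : T => tag s));
    [exact: cvg_snd|exact: tag_continuous].
- apply: (@ext_continuous _ T (fun s : T => tprod Psi (tstarP s)
    (emb (star (omega (tag s) (tag s)^-1%g))))) => s.
    by rewrite (factor_star_twist psi_pic fS cO).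
  apply: tprod_continuous.
    by apply: (tstarP_continuous (f := id)).
  apply: (@continuous_comp _ _ _
    (fun s : T => star (omega (tag s) (tag s)^-1%g)) emb); last exact: embC.
  apply: (@star_continuous _ _ T (fun s => omega (tag s) (tag s)^-1%g)) => {}s.
  apply: (@continuous_comp _ _ _ (fun s : T => (tag s, (tag s)^-1%g))
    (fun p => omega p.1 p.2)); last exact: cocycle2_continuous cO _.
  apply: (@pair_continuous T G G _ (fun s => (tag s)^-1%g)).
    exact: tag_continuous.
  move=> q; apply: (@continuous_comp _ _ _ (fun s : T => tag s)
    (fun g : G => g^-1%g)); first exact: tag_continuous.
  exact: invg_continuous.
Qed.

End FactorTopology.

(** * Continuity of families of central unitaries *)

Section UnitaryFamilies.
Variables (R : realType) (G : topGroupType) (B : cstarAlgType R).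
Variables (M : G -> bimod B) (iota : B -> M 1%g).
Variable (psi : G -> bimod B -> Prop).
Hypothesis psi_pic : forall g, is_pic (psi g).
Variable tau : topology_on (total_space M).
Variable (Psi : forall g h, M g -> M h -> M (g * h)%g).
Hypothesis fS : factor_system psi iota Psi.
Hypothesis fB : saturated_fell_bundle (factor_bundle iota tau Psi).

Let iM g : imprimitivity_bimodule (M g).
Proof. exact: (psi_imprimitivity psi_pic (factor_psi fS g)). Qed.

Let iota_iso := factor_unit fS.
Let bb : banach_bundle tau := fell_banach fB.1.
Let T := with_top tau.
Let emb (b : B) : T := intot (fib := M) (iota b).
Let tstarP (s : T) : T := intot (fib := M) (factor_star iota Psi (tagged s)).
Let iota_linear : linear iota := bimod_iso_linear iota_iso.
Let iota_isom : forall b, `|iota b| = `|b| := iota_norm psi_pic fS.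

(** Near a point of G, the inner products of vectors s and t and of their images
    Phi s and t, for s and t moving continuously, differ by the factor nu. *)
Lemma fiber_unitary_continuous (nu : G -> B)
    (Phi : forall g, M g -> M g) :
  (forall g, UZ (nu g)) -> (forall g (s : M g), Phi g s = lact _ (nu g) s) ->
  continuous (fun s : T => total_map (fib := M) (fib' := M) Phi s : T) ->
  continuous nu.
Proof.
move=> nuZ PhiE PhiC g; apply: (probe_continuous nuZ).
have [n [x [y <-]]] := lip_frame (iM g).
apply: probe_sum => i.
pose D (g : G) : set (T * T) := [set p | tag p.1 = g /\ tag p.2 = g].
pose f (p : T * T) : T := tprod Psi p.1 (tstarP p.2).
pose f' (p : T * T) : T :=
  tprod Psi (total_map (fib := M) (fib' := M) Phi p.1) (tstarP p.2).
have fE h (s t : M h) : f (intot (fib := M) s, intot (fib := M) t) =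
    emb (lip _ s t) by exact: (tprod_starr iM iota_iso fS).
have fE' h (s t : M h) : f' (intot (fib := M) s, intot (fib := M) t) =
    emb (nu h \cdot lip _ s t).
  by rewrite -lip_lact// -PhiE; exact: (tprod_starr iM iota_iso fS).
apply: (probe_lift bb iota_linear iota_isom (D := D) (f := f) (f' := f')
  (y0 := (intot (fib := M) (x i), intot (fib := M) (y i)))) => //.
- move=> U [[U1 U2] /= [/(fiber_lift bb) h1 /(fiber_lift bb) h2] U12].
  apply: filterS2 h1 h2 => h [s Us sh] [t Ut th].
  by exists (s, t); [exact: U12|].
- apply: (tprod_continuous fB); first exact: cvg_fst.
  by apply: (tstarP_continuous fB); exact: cvg_snd.
- apply: (tprod_continuous fB).
    by apply: (@continuous_comp _ _ _ fst
      (fun s : T => total_map (fib := M) (fib' := M) Phi s : T));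
      [exact: cvg_fst|exact: PhiC].
  by apply: (tstarP_continuous fB); exact: cvg_snd.
- move=> h [[h1 s] [h2 t]] [/= e1 e2]; subst h1 h2.
  by exists (lip _ s t); [exact: fE|exact: fE'].
Qed.

(** The same comparison for the two products of a pair of vectors, over a point
    of G * G. *)
Lemma product_unitary_continuous (omega : G -> G -> B)
    (Psi' : forall g h, M g -> M h -> M (g * h)%g) :
  factor_system psi iota Psi' ->
  saturated_fell_bundle (factor_bundle iota tau Psi') ->
  (forall g h, UZ (omega g h)) ->
  (forall g h (s : M g) (t : M h),
    Psi' g h s t = lact _ (omega g h) (Psi s t)) ->
  continuous (fun p : G * G => omega p.1 p.2).
Proof.
move=> fS' fB' oZ oE [g h].
apply: (@probe_continuous _ _ (G * G)%type (fun p => omega p.1 p.2)).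
  by case.
have [K [p [q <-]]] := prod_frame iM fS g h.
apply: probe_sum => k; case: (p k) (q k) => [s t] [s' t'] /=.
pose Y := ((T * T) * (T * T))%type.
pose D (x : G * G) : set Y := [set y | [/\ tag y.1.1 = x.1, tag y.1.2 = x.2,
  tag y.2.1 = x.1 & tag y.2.2 = x.2]].
pose f (y : Y) : T :=
  tprod Psi (tprod Psi y.1.1 y.1.2) (tstarP (tprod Psi y.2.1 y.2.2)).
pose f' (y : Y) : T :=
  tprod Psi (tprod Psi' y.1.1 y.1.2) (tstarP (tprod Psi y.2.1 y.2.2)).
have fE g1 h1 (s1 s2 : M g1) (t1 t2 : M h1) :
    f ((intot (fib := M) s1, intot (fib := M) t1),
       (intot (fib := M) s2, intot (fib := M) t2)) =
    emb (lip _ (Psi s1 t1) (Psi s2 t2)).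
  exact: (tprod_starr iM iota_iso fS).
have fE' g1 h1 (s1 s2 : M g1) (t1 t2 : M h1) :
    f' ((intot (fib := M) s1, intot (fib := M) t1),
       (intot (fib := M) s2, intot (fib := M) t2)) =
    emb (omega g1 h1 \cdot lip _ (Psi s1 t1) (Psi s2 t2)).
  by rewrite -lip_lact// -oE; exact: (tprod_starr iM iota_iso fS).
have c11 : continuous (fun y : Y => y.1.1).
  by move=> y; apply: (@continuous_comp _ _ _ fst fst); exact: cvg_fst.
have c12 : continuous (fun y : Y => y.1.2).
  by move=> y; apply: (@continuous_comp _ _ _ fst snd);
    [exact: cvg_fst|exact: cvg_snd].
have c21 : continuous (fun y : Y => y.2.1).
  by move=> y; apply: (@continuous_comp _ _ _ snd fst);
    [exact: cvg_snd|exact: cvg_fst].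
have c22 : continuous (fun y : Y => y.2.2).
  by move=> y; apply: (@continuous_comp _ _ _ snd snd); exact: cvg_snd.
have c2 (y : Y) : (fun y : Y => tstarP (tprod Psi y.2.1 y.2.2)) @ y -->
    tstarP (tprod Psi y.2.1 y.2.2).
  apply: (tstarP_continuous fB (f := fun y : Y => tprod Psi y.2.1 y.2.2)).
  by apply: (tprod_continuous fB); [exact: c21|exact: c22].
apply: (probe_lift bb iota_linear iota_isom (X := (G * G)%type)
  (om := fun p => omega p.1 p.2) (D := D) (f := f) (f' := f')
  (y0 := ((intot (fib := M) s, intot (fib := M) t),
          (intot (fib := M) s', intot (fib := M) t')))) => //.
- move=> U [[U1 U2] /= [[[V1 V2] /= [v1 v2] V12] [[W1 W2] /= [w1 w2] W12]] U12].
  have {}v1 := fiber_lift bb v1; have {}v2 := fiber_lift bb v2.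
  have {}w1 := fiber_lift bb w1; have {}w2 := fiber_lift bb w2.
  exists ([set x | (exists2 s' : T, V1 s' & tag s' = x) /\
                   (exists2 s' : T, W1 s' & tag s' = x)],
          [set x | (exists2 s' : T, V2 s' & tag s' = x) /\
                   (exists2 s' : T, W2 s' & tag s' = x)]).
    by split; apply: filterI.
  move=> [x1 x2] [/= [[a Va ax] [c Wc cx]] [[b Vb bx] [d Wd dx]]].
  exists ((a, b), (c, d)) => //.
  by apply: U12; split; [exact: V12|exact: W12].
- apply: (tprod_continuous fB); last exact: c2.
  by apply: (tprod_continuous fB); [exact: c11|exact: c12].
- apply: (tprod_continuous fB); last exact: c2.
  by apply: (tprod_continuous fB'); [exact: c11|exact: c12].
- move=> [g1 h1] [[[g2 a] [h2 b]] [[g3 c] [h3 d]]] [/= e1 e2 e3 e4].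
  subst g2 h2 g3 h3.
  by exists (lip _ (Psi a b) (Psi c d)); [exact: fE|exact: fE'].
Qed.

End UnitaryFamilies.

(** * Equivalence of Fell bundles *)

Section FellEquivalence.
Variables (R : realType) (G : topGroupType) (B : cstarAlgType R).
Implicit Types E F : fell_data G B.

Lemma linear_inverse (U V : lmodType R[i]) (f : U -> V) (f' : V -> U) :
  linear f -> cancel f f' -> cancel f' f -> linear f'.
Proof. by move=> fL fK f'K k x y; apply: (can_inj fK); rewrite fL !f'K. Qed.

Lemma fell_equivalent_refl F : fell_equivalent F F.
Proof.
exists (fun g => id); split=> //; split=> //; first by move=> g; exists id.
  rewrite (_ : (fun s => _) = id); first by move=> s; exact: cvg_id.
  by apply/funext => -[].
move=> U Uo; rewrite (_ : [set _ | _ in _] = U)//.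
apply/seteqP; split=> [_ [[g s] Us <-]//|[g s] Us].
by exists (existT _ g s).
Qed.

Lemma fell_equivalent_trans E F F' :
  fell_equivalent E F -> fell_equivalent F F' -> fell_equivalent E F'.
Proof.
move=> [Phi eP] [Phi' eP']; exists (fun g s => Phi' g (Phi g s)).
have [L N J C O] := fequiv_banach eP.
have [L' N' J' C' O'] := fequiv_banach eP'.
split; [split| | |].
- by move=> g k x y; rewrite L L'.
- by move=> g s; rewrite N' N.
- by move=> g; exact: bij_comp (J' g) (J g).
- move=> s; apply: (@continuous_comp _ _ _
    (fun s : with_top (ftop E) => total_map Phi s : with_top (ftop F))
    (fun s : with_top (ftop F) => total_map Phi' s : with_top (ftop F'))).
    exact: C.
  exact: C'.
- move=> U /O /O'; congr open; apply/seteqP; split=> x.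
    by move=> [_ [s Us <-] <-]; exists s.
  by move=> [s Us <-]; exists (total_map Phi s) => //; exists s.
- by move=> b; rewrite (fequiv_unit eP) (fequiv_unit eP').
- by move=> g h s t; rewrite (fequivM eP') (fequivM eP).
- by move=> g s; rewrite (fequiv_star eP') (fequiv_star eP).
Qed.

Lemma fell_equivalent_sym E F : fell_equivalent E F -> fell_equivalent F E.
Proof.
move=> [Phi eP]; have [L N J C O] := fequiv_banach eP.
have inv g : exists f : fib F g -> fib E g,
    cancel (Phi g) f /\ cancel f (Phi g).
  by have [f fK Kf] := J g; exists f.
pose Phi' g : fib F g -> fib E g := projT1 (cid (inv g)).
have K g : cancel (Phi g) (Phi' g) by case: (projT2 (cid (inv g))).
have K' g : cancel (Phi' g) (Phi g) by case: (projT2 (cid (inv g))).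
have tK : cancel (total_map Phi) (total_map Phi').
  by move=> [g s]; rewrite /total_map /= K.
have tK' : cancel (total_map Phi') (total_map Phi).
  by move=> [g s]; rewrite /total_map /= K'.
exists Phi'; split; [split| | |].
- by move=> g; exact: linear_inverse (L g) (K g) (K' g).
- by move=> g s; rewrite -N K'.
- by move=> g; exists (Phi g).
- apply/continuousP => U /O; congr open; apply/seteqP; split=> x.
    by move=> [s Us <-]; rewrite /preimage /= tK.
  by move=> Ux; exists (total_map Phi' x).
- move=> U Uo; have /continuousP/(_ _ Uo) := C; congr open.
  apply/seteqP; split=> x.
    by move=> Ux; exists (total_map Phi x).
  by move=> [s Us <-]; rewrite /preimage /= tK'.
- by move=> b; rewrite -(fequiv_unit eP) K.
- by move=> g h s t; apply: (can_inj (K _)); rewrite -(fequivM eP) !K'.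
- by move=> g s; apply: (can_inj (K _)); rewrite -(fequiv_star eP) !K'.
Qed.

Lemma fell_class_eq E F : fell_equivalent E F -> fell_class E = fell_class F.
Proof.
move=> EF; apply/funext => F'; apply/propext; split=> -[sat eq]; split=> //.
  exact: fell_equivalent_trans (fell_equivalent_sym EF) eq.
exact: fell_equivalent_trans EF eq.
Qed.

Lemma fell_class_inj E F : saturated_fell_bundle F ->
  fell_class E = fell_class F -> fell_equivalent E F.
Proof.
move=> sF eEF; have : fell_class F F by split=> //; exact: fell_equivalent_refl.
by rewrite -eEF => -[].
Qed.

End FellEquivalence.

(** * Cohomology classes *)

Section CentralAlgebra.
Variables (R : realType) (B : cstarAlgType R).
Implicit Types (a b c d u v w : B).

Lemma UZC u b : UZ u -> u \cdot b = b \cdot u.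
Proof. by case. Qed.

Lemma UZV u : UZ u -> u \cdot star u = cone.
Proof. by case. Qed.

Lemma UZVl u : UZ u -> star u \cdot u = cone.
Proof. by case. Qed.

Lemma cmulACA a b c d : UZ b ->
  (a \cdot b) \cdot (c \cdot d) = (a \cdot c) \cdot (b \cdot d).
Proof. by move=> bZ; rewrite !cmulA -(cmulA a) (UZC c bZ) cmulA. Qed.

(** With a, e and n the values of psi g on nu h, of nu at the product and of nu
    at g, the first equation says that w' and w differ by the coboundary of nu.
    The second one is the compatibility of multiplication by the stars of nu
    with the products twisted by w and w'. *)
Lemma unitary_transfer (a e n w w' : B) :
  UZ a -> UZ e -> UZ n -> UZ w ->
  w' = w \cdot (a \cdot star e \cdot n) <->
  w' \cdot (star n \cdot star a) = star e \cdot w.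
Proof.
move=> aZ eZ nZ wZ; have eZ' := UZ_star eZ; split=> [->|h].
  rewrite -cmulA -[RHS](UZC _ wZ); congr (w \cdot _).
  rewrite -cmulA [n \cdot _]cmulA UZV// cmul1l.
  by rewrite -(UZC a eZ') -cmulA UZV// cmul1r.
have -> : w' = (w' \cdot (star n \cdot star a)) \cdot (a \cdot n).
  rewrite -cmulA -(cmulA _ _ (a \cdot n)) (cmulA _ a) UZVl// cmul1l.
  by rewrite UZVl// cmul1r.
by rewrite h -(UZC a eZ') !cmulA (UZC _ wZ).
Qed.

End CentralAlgebra.

Section Cohomology.
Variables (R : realType) (G : topGroupType) (B : cstarAlgType R).
Variable psi : G -> bimod B -> Prop.
Hypothesis psi_pic : forall g, is_pic (psi g).
Implicit Types omega : G -> G -> B.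

Lemma cochain1_star (nu : G -> B) : cochain1 nu ->
  cochain1 (fun g => star (nu g)).
Proof.
move=> [nZ nC n1]; split; last by rewrite n1 star1.
  by move=> g; exact: UZ_star.
exact: star_continuous.
Qed.

Lemma coboundary_UZ (nu : G -> B) g h : cochain1 nu ->
  UZ (coboundary psi nu g h).
Proof.
move=> [nZ _ _]; rewrite /coboundary; apply: UZ_mul => //; apply: UZ_mul.
  exact: picard_act_UZ.
exact: UZ_star.
Qed.

Lemma coboundary1 g h : coboundary psi (fun _ => cone) g h = cone.
Proof. by rewrite /coboundary picard_act1// star1 !cmul1l. Qed.

Lemma coboundaryM (nu nu' : G -> B) g h : cochain1 nu -> cochain1 nu' ->
  coboundary psi (fun g => nu g \cdot nu' g) g h =
  coboundary psi nu g h \cdot coboundary psi nu' g h.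
Proof.
move=> [nZ _ _] [nZ' _ _]; rewrite /coboundary picard_actM// starM.
have aZ := picard_act_UZ psi_pic g (nZ' h).
have eZ := UZ_star (nZ' (g * h)%g).
by rewrite (UZC _ eZ) (cmulACA _ _ _ aZ) (cmulACA _ _ _ (UZ_mul aZ eZ)).
Qed.

Lemma cohomologous_refl omega : cohomologous psi omega omega.
Proof.
exists (fun _ => cone); last by move=> g h; rewrite coboundary1 cmul1r.
by split=> //; [move=> g; exact: UZ1|move=> g; exact: cvg_cst].
Qed.

Lemma cochain1_mul (nu nu' : G -> B) : cochain1 nu -> cochain1 nu' ->
  cochain1 (fun g => nu g \cdot nu' g).
Proof.
move=> [nZ nC n1] [nZ' nC' n1']; split; last by rewrite n1 n1' cmul1l.
  by move=> g; exact: UZ_mul.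
exact: UZ_mul_continuous.
Qed.

Lemma cohomologous_mul (omega1 omega2 omega1' omega2' : G -> G -> B) :
  cohomologous psi omega1 omega1' -> cohomologous psi omega2 omega2' ->
  cohomologous psi (fun g h => omega1 g h \cdot omega2 g h)
    (fun g h => omega1' g h \cdot omega2' g h).
Proof.
move=> [nu nuZ e] [nu' nuZ' e'].
exists (fun g => nu g \cdot nu' g); first exact: cochain1_mul.
move=> g h; rewrite e e' coboundaryM//.
by rewrite cmulACA//; exact: coboundary_UZ.
Qed.

Lemma cohomologous_trans omega1 omega2 omega3 :
  cohomologous psi omega1 omega2 ->
  cohomologous psi omega2 omega3 -> cohomologous psi omega1 omega3.
Proof.
move=> [nu nuZ e] [nu' nuZ' e'].
exists (fun g => nu g \cdot nu' g); first exact: cochain1_mul.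
by move=> g h; rewrite e' e coboundaryM// cmulA.
Qed.

Lemma cohomologous_sym omega1 omega2 : cohomologous psi omega1 omega2 ->
  cohomologous psi omega2 omega1.
Proof.
move=> [nu nuZ e]; have nuZ' := cochain1_star nuZ.
exists (fun g => star (nu g)) => // g h.
rewrite e -cmulA -coboundaryM// (_ : (fun g => _) = fun _ => cone).
  by rewrite coboundary1 cmul1r.
by apply/funext => x; rewrite UZV//; apply: cochain1_UZ nuZ x.
Qed.

Lemma H2_class_eq omega1 omega2 : cohomologous psi omega1 omega2 ->
  H2_class psi omega1 = H2_class psi omega2.
Proof.
move=> e12; apply/seteqP; split=> omega [cO e]; split=> //.
  exact: cohomologous_trans (cohomologous_sym e12) e.
exact: cohomologous_trans e12 e.
Qed.

Lemma H2_class_refl omega : cocycle2 psi omega -> H2_class psi omega omega.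
Proof. by move=> cO; split=> //; exact: cohomologous_refl. Qed.

Lemma cocycle2_mul omega1 omega2 : cocycle2 psi omega1 -> cocycle2 psi omega2 ->
  cocycle2 psi (fun g h => omega1 g h \cdot omega2 g h).
Proof.
move=> c1 c2; have Z1 := cocycle2_UZ c1; have Z2 := cocycle2_UZ c2.
split.
- by move=> g h; exact: UZ_mul.
- apply: (@UZ_mul_continuous _ _ (G * G)%type (fun p => omega1 p.1 p.2)
    (fun p => omega2 p.1 p.2)) => //; first exact: cocycle2_continuous c1.
  exact: cocycle2_continuous c2.
- by move=> g; rewrite (cocycle2_1l c1) (cocycle2_1l c2) cmul1l.
- by move=> g; rewrite (cocycle2_1r c1) (cocycle2_1r c2) cmul1l.
- move=> g h k; rewrite picard_actM// cmulACA; last exact: picard_act_UZ.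
  by rewrite (cocycle2_eq c1) (cocycle2_eq c2) cmulACA.
Qed.

Lemma cocycle2_one : cocycle2 psi (fun _ _ => cone).
Proof.
split=> //; first by move=> g h; exact: UZ1.
  by move=> p; exact: cvg_cst.
by move=> g h k; rewrite picard_act1.
Qed.

Lemma H2_mul_class omega1 omega2 : cocycle2 psi omega1 -> cocycle2 psi omega2 ->
  H2_mul psi (H2_class psi omega1) (H2_class psi omega2) =
  H2_class psi (fun g h => omega1 g h \cdot omega2 g h).
Proof.
move=> c1 c2; apply/seteqP; split=> omega.
  move=> [cO [w1 [w2 [[_ e1] [_ e2] e]]]]; split=> //.
  exact: cohomologous_trans (cohomologous_mul e1 e2) e.
move=> [cO e]; split=> //; exists omega1, omega2.
by split=> //; exact: H2_class_refl.
Qed.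

End Cohomology.

(** * Equivalences between factor systems on the same bimodules *)

Section FactorEquivalence.
Variables (R : realType) (G : topGroupType) (B : cstarAlgType R).
Variables (M : G -> bimod B) (iota : B -> M 1%g).
Variable (psi : G -> bimod B -> Prop).
Hypothesis psi_pic : forall g, is_pic (psi g).
Variable tau : topology_on (total_space M).
Variables Psi Psi' : forall g h, M g -> M h -> M (g * h)%g.
Hypothesis fS : factor_system psi iota Psi.
Hypothesis fS' : factor_system psi iota Psi'.

Let iM g : imprimitivity_bimodule (M g).
Proof. exact: (psi_imprimitivity psi_pic (factor_psi fS g)). Qed.

Let iota_iso := factor_unit fS.

Section Multiplicative.
Variable Phi : forall g, M g -> M g.
Hypothesis Phi1 : forall b, Phi (iota b) = iota b.
Hypothesis PhiM : forall g h (s : M g) (t : M h),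
  Psi' (Phi s) (Phi t) = Phi (Psi s t).

Let tPhi := total_map (fib := M) (fib' := M) Phi.

Lemma total_map_tprod x y : tPhi (tprod Psi x y) = tprod Psi' (tPhi x) (tPhi y).
Proof. by rewrite /tPhi /total_map /tprod /= PhiM. Qed.

Lemma multiplicative_lact g b (s : M g) : Phi (lact _ b s) = lact _ b (Phi s).
Proof.
apply: (@intot_inj _ _ M).
rewrite -[LHS]/(tPhi (intot (fib := M) (lact _ b s))).
rewrite -(tprod_lact iM iota_iso fS) total_map_tprod {1}/tPhi /total_map /=.
by rewrite Phi1 (tprod_lact iM iota_iso fS').
Qed.

(** The star of s is characterized by its inner products, which are products
    with s; so it is preserved along with products and inner products. *)
Lemma multiplicative_star : (forall g, bijective (@Phi g)) ->
  (forall g (s t : M g), rip _ (Phi s) (Phi t) = rip _ s t) ->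
  forall g (s : M g),
    factor_star iota Psi' (Phi s) = Phi (factor_star iota Psi s).
Proof.
move=> Phib Phir g s; apply: (@intot_inj _ _ M).
apply: (factor_star_uniq iM iota_iso fS') => // t.
have [j _ jK] := Phib (g^-1)%g; rewrite -(jK t) Phir.
transitivity (tPhi (tprod Psi (intot (fib := M) s) (intot (fib := M) (j t)))).
  by rewrite total_map_tprod.
by rewrite (factor_star_spec iM iota_iso fS) /tPhi /total_map /= Phi1.
Qed.

Lemma star_preserving_rip : (forall g (s : M g),
    factor_star iota Psi' (Phi s) = Phi (factor_star iota Psi s)) ->
  forall g (s t : M g), rip _ (Phi s) (Phi t) = rip _ s t.
Proof.
move=> PhiS g s t; apply: (iota_inj iota_iso).
rewrite -(tprod_star iM iota_iso fS') PhiS.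
transitivity (tPhi (tprod Psi (intot (fib := M) (factor_star iota Psi s))
  (intot (fib := M) t))); first by rewrite total_map_tprod.
by rewrite (tprod_star iM iota_iso fS) /tPhi /total_map /= Phi1.
Qed.

Lemma star_preserving_lip : (forall g (s : M g),
    factor_star iota Psi' (Phi s) = Phi (factor_star iota Psi s)) ->
  forall g (s t : M g), lip _ (Phi s) (Phi t) = lip _ s t.
Proof.
move=> PhiS g s t; apply: (iota_inj iota_iso).
rewrite -(tprod_starr iM iota_iso fS') PhiS.
transitivity (tPhi (tprod Psi (intot (fib := M) s)
  (intot (fib := M) (factor_star iota Psi t)))).
  by rewrite total_map_tprod.
by rewrite (tprod_starr iM iota_iso fS) /tPhi /total_map /= Phi1.
Qed.

Lemma factor_fell_equivalence :
  (forall g (s t : M g), rip _ (Phi s) (Phi t) = rip _ s t) ->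
  banach_equivalence tau tau Phi ->
  fell_equivalence (F := factor_bundle iota tau Psi)
    (F' := factor_bundle iota tau Psi') Phi.
Proof.
move=> Phir be; split=> //=.
by apply: multiplicative_star => //; exact: bequiv_bij be.
Qed.

End Multiplicative.

Lemma fell_equivalence_rip (Phi : forall g, M g -> M g) :
  fell_equivalence (F := factor_bundle iota tau Psi)
    (F' := factor_bundle iota tau Psi') Phi ->
  forall g (s t : M g), rip _ (Phi g s) (Phi g t) = rip _ s t.
Proof.
move=> eP; apply: star_preserving_rip => //.
- exact: (fequiv_unit eP).
- exact: (fequivM eP).
- exact: (fequiv_star eP).
Qed.

Lemma fell_equivalence_lip (Phi : forall g, M g -> M g) :
  fell_equivalence (F := factor_bundle iota tau Psi)
    (F' := factor_bundle iota tau Psi') Phi ->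
  forall g (s t : M g), lip _ (Phi g s) (Phi g t) = lip _ s t.
Proof.
move=> eP; apply: star_preserving_lip => //.
- exact: (fequiv_unit eP).
- exact: (fequivM eP).
- exact: (fequiv_star eP).
Qed.

Lemma fell_equivalence_lact (Phi : forall g, M g -> M g) :
  fell_equivalence (F := factor_bundle iota tau Psi)
    (F' := factor_bundle iota tau Psi') Phi ->
  forall g b (s : M g), Phi g (lact _ b s) = lact _ b (Phi g s).
Proof.
move=> eP; apply: multiplicative_lact => //.
- exact: (fequiv_unit eP).
- exact: (fequivM eP).
Qed.

(** For each g and h the two products of a pair of vectors have the same inner
    products with the products of other pairs, hence differ by a central
    unitary.  The cocycle equation compares the two bracketings of a threefold
    product. *)
Lemma factor_systems_differ_by_cocycle :
  saturated_fell_bundle (factor_bundle iota tau Psi) ->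
  saturated_fell_bundle (factor_bundle iota tau Psi') ->
  exists2 omega, cocycle2 psi omega & twist omega Psi = Psi'.
Proof.
move=> fB fB'.
have tiso := factor_iso fS; have tiso' := factor_iso fS'.
have : forall p : G * G, exists u, UZ u /\ forall (s : M p.1) (t : M p.2),
    Psi' s t = lact _ u (Psi s t).
  move=> [g h] /=; have [K [p [q e]]] := prod_frame iM fS g h.
  have [|||u uZ uE] := @central_unitary _ _ _ (iM (g * h)%g) _
    (fun p : M g * M h => Psi p.1 p.2) (fun p => Psi' p.1 p.2) K p q e.
  - by move=> i j; rewrite (tensor_lip (tiso _ _)) (tensor_lip (tiso' _ _)).
  - by move=> i j; rewrite (tensor_rip (tiso _ _)) (tensor_rip (tiso' _ _)).
  - move=> b [s t]; exists (lact _ b s, t) => /=.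
      by rewrite (tensor_lact (tiso _ _)).
    by rewrite (tensor_lact (tiso' _ _)).
  by exists u; split=> // s t; exact: (uE (s, t)).
move=> /choice[u uP]; pose omega g h := u (g, h).
have oZ g h : UZ (omega g h) by case: (uP (g, h)).
have oE g h (s : M g) (t : M h) : Psi' s t = lact _ (omega g h) (Psi s t).
  by case: (uP (g, h)) => _ /(_ s t).
exists omega; last first.
  by do 4 (apply: functional_extensionality_dep => ?); rewrite oE.
split=> //.
- exact: (product_unitary_continuous psi_pic fS fB fS' fB').
- move=> g; apply: (prod_lact_inj iM fS (g := 1%g) (h := g)) => s t.
  rewrite -oE lact1//.
  have [b sb] := iota_surj iota_iso erefl s.
  have {sb}-> := @intot_inj _ _ M _ _ _ sb.
  apply: (@intot_inj _ _ M); transitivity (intot (fib := M) (lact _ b t)).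
    exact: (tprod_lact iM iota_iso fS').
  exact/esym/(tprod_lact iM iota_iso fS).
- move=> g; apply: (prod_lact_inj iM fS (g := g) (h := 1%g)) => s t.
  rewrite -oE lact1//.
  have [b tb] := iota_surj iota_iso erefl t.
  have {tb}-> := @intot_inj _ _ M _ _ _ tb.
  apply: (@intot_inj _ _ M); transitivity (intot (fib := M) (ract _ s b)).
    exact: (tprod_ract iM iota_iso fS').
  exact/esym/(tprod_ract iM iota_iso fS).
move=> g h k; apply/esym.
apply: (prod_lact_inj iM fS (g := g) (h := h)) => r s.
apply: (prod_left_inj iM fS (h := k)) => t.
rewrite -!(tensor_lact (tiso _ _)) !(tensor_lact (tiso g h)).
rewrite !(tensor_lact (tiso _ k)); apply: (@intot_inj _ _ M).
transitivity (tprod Psi' (tprod Psi' (intot (fib := M) r) (intot (fib := M) s))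
  (intot (fib := M) t)).
  by rewrite /tprod /= !oE (tensor_lact (tiso _ _)) lactM.
rewrite (tprodA fS') /tprod /= !oE -(tensor_balanced (tiso _ _)).
rewrite -(picard_act_lact psi_pic _ (oZ h k) (factor_psi fS g)).
rewrite (tensor_lact (tiso _ _)) -lactM//.
rewrite (UZC _ (oZ g (h * k)%g)).
exact/intot_lact/esym/(factorA fS).
Qed.

End FactorEquivalence.

Section TwistEquivalence.
Variables (R : realType) (G : topGroupType) (B : cstarAlgType R).
Variables (M : G -> bimod B) (iota : B -> M 1%g).
Variable (psi : G -> bimod B -> Prop).
Hypothesis psi_pic : forall g, is_pic (psi g).
Variable tau : topology_on (total_space M).

Lemma Psi_lact2 (Psi : forall g h, M g -> M h -> M (g * h)%g) g h
    (s : M g) (t : M h) (u v : B) :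
  factor_system psi iota Psi -> UZ v ->
  Psi _ _ (lact _ u s) (lact _ v t) =
  lact _ (u \cdot picard_act psi g v) (Psi _ _ s t).
Proof.
move=> fS vZ; have iM g' : imprimitivity_bimodule (M g').
  exact: (psi_imprimitivity psi_pic (factor_psi fS g')).
have tiso := factor_iso fS g h.
rewrite (tensor_lact tiso) -(tensor_balanced tiso).
rewrite -(picard_act_lact psi_pic _ vZ (factor_psi fS g)) (tensor_lact tiso).
by rewrite lactM.
Qed.

Section FixedFactorSystem.
Variable Psi : forall g h, M g -> M h -> M (g * h)%g.
Hypothesis fS : factor_system psi iota Psi.
Hypothesis fB : saturated_fell_bundle (factor_bundle iota tau Psi).

Let iM g : imprimitivity_bimodule (M g).
Proof. exact: (psi_imprimitivity psi_pic (factor_psi fS g)). Qed.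

Let T := with_top tau.

Lemma lact_total_continuous (nu : G -> B) : continuous nu ->
  continuous (fun s : T => total_map (fib := M) (fib' := M)
    (fun g => lact (M g) (nu g)) s : T).
Proof.
move=> nuC; apply: (@ext_continuous _ T (fun s : T => tprod Psi
  (intot (fib := M) (iota (nu (tag s)))) s : T)) => s.
  by rewrite [in RHS](intot_tagged s) (tprod_lact iM (factor_unit fS) fS).
apply: (tprod_continuous fB (f := fun s : T => _)); last exact: cvg_id.
apply: (@continuous_comp _ _ _ (fun s : T => nu (tag s))
  (fun b => intot (fib := M) (iota b) : T)).
  apply: (@continuous_comp _ _ _ (fun s : T => tag s) nu); last exact: nuC.
  exact: (tag_continuous fB).
apply: (emb_continuous (fell_banach fB.1)).
  exact: bimod_iso_linear (factor_unit fS).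
exact: iota_norm psi_pic _ fS.
Qed.

Lemma lact_banach_equivalence (nu : G -> B) : (forall g, UZ (nu g)) ->
  continuous nu ->
  banach_equivalence tau tau (fun g => lact (M g) (nu g)).
Proof.
move=> nZ nC.
pose n' g := star (nu g).
have K (g : G) : cancel (lact (M g) (nu g)) (lact (M g) (n' g)).
  by move=> x; rewrite -lactM// UZVl// lact1.
have K' (g : G) : cancel (lact (M g) (n' g)) (lact (M g) (nu g)).
  by move=> x; rewrite -lactM// UZV// lact1.
split.
- by move=> g k x y; rewrite lactDr// lactZr.
- by move=> g s; exact: UZ_lact_norm.
- by move=> g; exists (lact (M g) (n' g)).
- exact: lact_total_continuous.
move=> U Uo; have := lact_total_continuous (star_continuous nC).
move/continuousP => /(_ _ Uo); congr open; apply/seteqP; split=> [[g s] Us|s].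
  by exists (intot (fib := M) (lact (M g) (n' g) s)) => //;
    rewrite /total_map /= K'.
by move=> [[g t] Us <-]; rewrite /preimage /total_map /= K.
Qed.

(** If nu bounds the difference of the cocycles, the equivalence multiplies the
    fiber over g by the star of nu g. *)
Lemma twist_equivalent_cohomologous omega omega' :
  cocycle2 psi omega -> cocycle2 psi omega' -> cohomologous psi omega omega' ->
  fell_equivalent (factor_bundle iota tau (twist omega Psi))
    (factor_bundle iota tau (twist omega' Psi)).
Proof.
move=> cO cO' [nu nC e]; have [nZ' nC' n1'] := cochain1_star nC.
have nZ := cochain1_UZ nC.
have fO := twist_factor_system psi_pic fS cO.
have fO' := twist_factor_system psi_pic fS cO'.
exists (fun g => lact (M g) (star (nu g))).
apply: (factor_fell_equivalence psi_pic fO fO') => //.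
- by move=> b; rewrite n1' lact1.
- move=> g h s t; rewrite /twist (Psi_lact2 _ _ _ fS)// -!lactM//.
  congr (lact _ _ _); rewrite (picard_act_star psi_pic)//.
  by apply/unitary_transfer => //;
    [exact: picard_act_UZ|exact: cocycle2_UZ cO _ _].
- by move=> g s t; exact: UZ_rip.
exact: lact_banach_equivalence.
Qed.

(** An equivalence restricts to a bimodule automorphism of each fiber, hence is
    multiplication by central unitaries nu g; their stars bound the difference
    of the cocycles. *)
Lemma cohomologous_twist_equivalent omega omega' :
  cocycle2 psi omega -> cocycle2 psi omega' ->
  fell_equivalent (factor_bundle iota tau (twist omega Psi))
    (factor_bundle iota tau (twist omega' Psi)) ->
  cohomologous psi omega omega'.
Proof.
move=> cO cO' [Phi eP].
have fO := twist_factor_system psi_pic fS cO.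
have fO' := twist_factor_system psi_pic fS cO'.
have PhiB := fell_equivalence_lact psi_pic fO fO' eP.
have : forall g, exists u, UZ u /\ forall s : M g, Phi g s = lact _ u s.
  move=> g; have [n [x [y xy]]] := lip_frame (iM g).
  have [|||u uZ uE] := @central_unitary _ _ _ (iM g) _ id (Phi g) _ x y xy.
  - exact: (fell_equivalence_lip psi_pic fO fO' eP).
  - exact: (fell_equivalence_rip psi_pic fO fO' eP).
  - by move=> b s; exists (lact _ b s).
  by exists u.
move=> /choice[nu nuP].
have nZ g : UZ (nu g) by case: (nuP g).
have nE g (s : M g) : Phi g s = lact _ (nu g) s by case: (nuP g).
have nC : continuous nu.
  apply: (fiber_unitary_continuous psi_pic fS fB nZ nE).
  exact: (bequiv_continuous (fequiv_banach eP)).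
have n1 : nu 1%g = cone.
  apply: (lact_inj (iM 1%g)) => s.
  have [b sb] := iota_surj (factor_unit fS) erefl s.
  have {sb}-> := @intot_inj _ _ M _ _ _ sb.
  by rewrite -nE (fequiv_unit eP) lact1.
have c1 : cochain1 nu by [].
exists (fun g => star (nu g)); first exact: cochain1_star.
move=> g h; rewrite /coboundary (picard_act_star psi_pic)//.
apply/unitary_transfer; first by apply/UZ_star/picard_act_UZ.
- exact: UZ_star.
- exact: UZ_star.
- exact: cocycle2_UZ cO _ _.
rewrite !starK; apply: (prod_lact_inj iM fS (g := g) (h := h)) => s t.
rewrite lactM// -(Psi_lact2 _ _ _ fS)// -!nE.
have := fequivM eP s t; rewrite /= /twist => ->.
by rewrite PhiB nE -!lactM// (UZC (omega g h) (nZ (g * h)%g)).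
Qed.

End FixedFactorSystem.

Lemma twist_equivalent (Psi Psi' : forall g h, M g -> M h -> M (g * h)%g)
    omega :
  factor_system psi iota Psi -> factor_system psi iota Psi' ->
  cocycle2 psi omega ->
  fell_equivalent (factor_bundle iota tau Psi) (factor_bundle iota tau Psi') ->
  fell_equivalent (factor_bundle iota tau (twist omega Psi))
    (factor_bundle iota tau (twist omega Psi')).
Proof.
move=> fS fS' cO [Phi eP]; exists Phi.
apply: (factor_fell_equivalence psi_pic).
- exact: twist_factor_system.
- exact: twist_factor_system.
- exact: (fequiv_unit eP).
- move=> g h s t; rewrite /twist (fell_equivalence_lact psi_pic fS fS' eP).
  by congr (lact _ _ _); exact: (fequivM eP).
- exact: (fell_equivalence_rip psi_pic fS fS' eP).
exact: (fequiv_banach eP).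
Qed.

Lemma twist_one (Psi : forall g h, M g -> M h -> M (g * h)%g) :
  factor_system psi iota Psi -> twist (fun _ _ => cone) Psi = Psi.
Proof.
move=> fS; do 4 (apply: functional_extensionality_dep => ?).
by rewrite /twist lact1//; exact: (psi_imprimitivity psi_pic (factor_psi fS _)).
Qed.

Lemma twist_mul (Psi : forall g h, M g -> M h -> M (g * h)%g) omega omega' :
  factor_system psi iota Psi ->
  twist (fun g h => omega g h \cdot omega' g h) Psi =
  twist omega (twist omega' Psi).
Proof.
move=> fS; do 4 (apply: functional_extensionality_dep => ?).
by rewrite /twist lactM//; exact: (psi_imprimitivity psi_pic (factor_psi fS _)).
Qed.

End TwistEquivalence.

(** * The factor system of a Fell bundle *)

Section IsoTransport.
Variables (R : realType) (B : cstarAlgType R) (M N : bimod B) (f : M -> N).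

(** The norms enter as hypotheses because an isomorphism of bimodules is only
    required to preserve inner products. *)
Lemma bimod_iso_imprimitivity : bimod_iso f -> imprimitivity_bimodule N ->
  (forall x : M, `|x| ^+ 2 = `|lip M x x|) ->
  (forall x : M, `|x| ^+ 2 = `|rip M x x|) -> imprimitivity_bimodule M.
Proof.
move=> fI iN nl nr; have fJ := bij_inj (bimod_iso_bij fI).
have [j _ jK] := bimod_iso_bij fI.
have fD := bimod_isoD fI; have fZ := bimod_isoZ fI.
have fl := bimod_iso_lact fI; have fr := bimod_iso_ract fI.
have fil := bimod_iso_lip fI; have fir := bimod_iso_rip fI.
split=> //.
- by move=> x; apply: fJ; rewrite fl lact1.
- by move=> a b x; apply: fJ; rewrite !fl lactM.
- by move=> a b x; apply: fJ; rewrite fD !fl lactDl.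
- by move=> a x y; apply: fJ; rewrite !(fD, fl) lactDr.
- by move=> k a x; apply: fJ; rewrite !(fZ, fl) lactZl.
- by move=> k a x; apply: fJ; rewrite !(fZ, fl) lactZr.
- by move=> x; apply: fJ; rewrite fr ract1.
- by move=> x a b; apply: fJ; rewrite !fr ractM.
- by move=> x a b; apply: fJ; rewrite fD !fr ractDr.
- by move=> x y a; apply: fJ; rewrite !(fD, fr) ractDl.
- by move=> k x a; apply: fJ; rewrite !(fZ, fr) ractZr.
- by move=> k x a; apply: fJ; rewrite !(fZ, fr) ractZl.
- by move=> a x b; apply: fJ; rewrite !(fl, fr) lractA.
- by move=> x y z; rewrite -!fil fD lipD.
- by move=> k x y; rewrite -!fil fZ lipZ.
- by move=> b x y; rewrite -!fil fl lip_lact.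
- by move=> x y; rewrite -!fil lip_star.
- by move=> x; rewrite -fil; exact: lip_ge0.
- rewrite (_ : [set lip M p.1 p.2 | p in _] =
      [set lip N p.1 p.2 | p in [set: N * N]]); first exact: lip_full.
  apply/seteqP; split=> _ [[x y] _ <-] /=;
    first by exists (f x, f y); rewrite //= fil.
  by exists (j x, j y); rewrite //= -fil !jK.
- by move=> x y z; rewrite -!fir fD ripD.
- by move=> k x y; rewrite -!fir fZ ripZ.
- by move=> x y b; rewrite -!fir fr rip_ract.
- by move=> x y; rewrite -!fir rip_star.
- by move=> x; rewrite -fir; exact: rip_ge0.
- rewrite (_ : [set rip M p.1 p.2 | p in _] =
      [set rip N p.1 p.2 | p in [set: N * N]]); first exact: rip_full.
  apply/seteqP; split=> _ [[x y] _ <-] /=;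
    first by exists (f x, f y); rewrite //= fir.
  by exists (j x, j y); rewrite //= -fir !jK.
- by move=> b x y; rewrite -!fir !fl rip_lact.
- by move=> x y b; rewrite -!fil !fr lip_ract.
- by move=> x y z; apply: fJ; rewrite fl fr -fil -fir lip_rip.
Qed.

End IsoTransport.

Section FellFactorSystem.
Variables (R : realType) (G : topGroupType) (B : cstarAlgType R).
Variable psi : G -> bimod B -> Prop.
Hypothesis psi_pic : forall g, is_pic (psi g).
Variable F : fell_data G B.
Hypothesis sF : saturated_fell_bundle F.
Hypothesis psiF : picard F = psi.

Let fF : fell_bundle F := sF.1.
Local Notation M := (fiber_bimod F).
Let emb (b : B) : total_space (fib F) := intot (funit F b).

Let emb_inj a b : emb a = emb b -> a = b.
Proof. by move/(@intot_inj _ _ (fib F))/(bij_inj (funit_bij fF)). Qed.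

Lemma fiber_lactE g b (s : M g) :
  intot (fib := fib F) (lact (M g) b s) = tmul (emb b) (intot (fib := fib F) s).
Proof. exact: intot_fcast. Qed.

Lemma fiber_ractE g b (s : M g) :
  intot (fib := fib F) (ract (M g) s b) = tmul (intot (fib := fib F) s) (emb b).
Proof. exact: intot_fcast. Qed.

Lemma fiber_lipE g (s t : M g) : emb (lip (M g) s t) =
  tmul (intot (fib := fib F) s) (tstar (intot (fib := fib F) t)).
Proof.
by rewrite /emb /= unit_invK ?intot_fcast//; exact: funit_bij fF.
Qed.

Lemma fiber_ripE g (s t : M g) : emb (rip (M g) s t) =
  tmul (tstar (intot (fib := fib F) s)) (intot (fib := fib F) t).
Proof.
by rewrite /emb /= unit_invK ?intot_fcast//; exact: funit_bij fF.
Qed.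

Lemma fstar_norm g (s : fib F g) : `|fstar s| = `|s|.
Proof.
have le h (t : fib F h) : `|t| <= `|fstar t|.
  have [->|t0] := eqVneq t 0; first by rewrite normr0 normr_ge0.
  have t_gt0 : 0 < `|t| by rewrite normr_gt0.
  by rewrite -(ler_pM2r t_gt0) -expr2 -(fstar_identity fF) fmul_norm.
apply/eqP; rewrite eq_le le andbT; apply: le_trans (le _ (fstar s)) _.
by have /(congr1 (fun x : total_space (fib F) => `|tagged x|)) /= -> :=
  fstarK fF (intot (fib := fib F) s).
Qed.

Lemma emb_norm b : `|tagged (emb b)| = `|b|.
Proof. exact: (funit_norm fF). Qed.

(** The Picard homomorphism being psi, the fiber is isomorphic to an
    imprimitivity bimodule; the C*-identity gives the compatibility of norms. *)
Lemma fiber_imprimitivity g : imprimitivity_bimodule (M g).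
Proof.
have := psi_pic g; rewrite -psiF /picard => -[N iN MN].
have [_ [f fI]] : pic_class (M g) N.
  by rewrite MN; split=> //; exists id; exact: bimod_iso_id.
apply: (bimod_iso_imprimitivity fI iN) => x.
- rewrite -emb_norm fiber_lipE -(fstar_norm x).
  rewrite -(fstar_identity fF).
  have e : tmul (intot (fib := fib F) x) (tstar (intot (fib := fib F) x)) =
    tmul (tstar (tstar (intot (fib := fib F) x)))
      (tstar (intot (fib := fib F) x)) by rewrite (fstarK fF).
  by rewrite e.
by rewrite -emb_norm fiber_ripE -(fstar_identity fF).
Qed.

Lemma fiber_psi g : psi g (M g).
Proof.
rewrite -psiF; split; first exact: fiber_imprimitivity.
by exists id; exact: bimod_iso_id.
Qed.

Lemma fmul_tensor_iso g h : tensor_iso (P := M (g * h)%g)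
  (fun (s : M g) (t : M h) => fmul s t).
Proof.
have inj k := @intot_inj _ _ (fib F) k.
have tmulE k l (s : M k) (t : M l) : intot (fib := fib F) (fmul s t) =
  tmul (intot (fib := fib F) s) (intot (fib := fib F) t) by [].
have A := fmulA fF; have S := fstarM fF; have K := fstarK fF.
split.
- exact: (fmul_linl fF).
- exact: (fmul_linr fF).
- move=> s b t; apply: inj.
  by rewrite !tmulE fiber_ractE fiber_lactE A.
- move=> b s t; apply: inj.
  by rewrite tmulE !fiber_lactE tmulE A.
- move=> s t b; apply: inj.
  by rewrite tmulE !fiber_ractE tmulE A.
- move=> s t s' t'; apply: emb_inj.
  by rewrite !fiber_lipE fiber_ractE fiber_lipE !tmulE S !A.
- move=> s t s' t'; apply: emb_inj.
  by rewrite !fiber_ripE fiber_lactE fiber_ripE !tmulE S !A.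
exact: sF.2.
Qed.

Lemma funit_bimod_iso : bimod_iso (M := self_bimod B) (N := M 1%g) (funit F).
Proof.
have inj := @intot_inj _ _ (fib F).
split=> /=.
- exact: (funit_linear fF).
- exact: (funit_bij fF).
- by move=> b x; apply: inj; rewrite fiber_lactE; exact: (funitM fF).
- by move=> b x; apply: inj; rewrite fiber_ractE; exact: (funitM fF).
- move=> x y; apply: emb_inj; rewrite fiber_lipE.
  by rewrite -(funit_star fF) -(funitM fF).
- move=> x y; apply: emb_inj; rewrite fiber_ripE.
  by rewrite -(funit_star fF) -(funitM fF).
Qed.

Lemma fell_bundle_factor_system :
  factor_system psi (M := M) (funit F) (@fmul R G B F).
Proof.
split.
- exact: fiber_psi.
- exact: funit_bimod_iso.
- exact: fmul_tensor_iso.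
- by move=> a b; exact/esym/(funitM fF).
- by move=> g h k r s t; exact/esym/(fmulA fF (intot (fib := fib F) r)
    (intot (fib := fib F) s) (intot (fib := fib F) t)).
Qed.

(** In a Fell bundle the product of s and t is the inner product of the star of
    s with t, which is what defines the star of a factor system. *)
Lemma factor_star_fstar g (s : M g) :
  factor_star (M := M) (funit F) (@fmul R G B F) s = fstar s.
Proof.
apply: (@intot_inj _ _ M).
apply: (factor_star_uniq fiber_imprimitivity funit_bimod_iso
  fell_bundle_factor_system) => // t.
rewrite -[RHS]/(emb _) fiber_ripE.
rewrite -[X in _ = tmul (tstar X) _]/(tstar (intot (fib := fib F) s)).
by rewrite (fstarK fF).
Qed.

Lemma factor_bundle_fmul (tau : topology_on (total_space (fib F))) :
  factor_bundle (M := M) (funit F) tau (@fmul R G B F) = retop tau.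
Proof.
rewrite /factor_bundle /retop; congr FellData.
apply: functional_extensionality_dep => g; apply/funext => s.
exact: factor_star_fstar.
Qed.

End FellFactorSystem.

(** * The action on extension classes *)

Section ExtAction.
Variables (R : realType) (G : topGroupType) (B : cstarAlgType R).
Variable psi : G -> bimod B -> Prop.
Hypothesis psi_pic : forall g, is_pic (psi g).
Variable F : fell_data G B.
Hypothesis psiF : picard F = psi.
Variable tau : topology_on (total_space (fib F)).

Local Notation M := (fiber_bimod F).
Local Notation fbundle := (factor_bundle (M := M) (funit F) tau).
Local Notation product :=
  (forall g h : G, fib F g -> fib F h -> fib F (g * h)%g).
Local Notation twisted omega Psi := (twist (M := M) omega Psi).

Lemma Ext_factor_bundle (Psi : product) : fell_factor_system psi tau Psi ->
  Ext psi tau (fell_class (fbundle Psi)).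
Proof.
move=> [fS fB]; exists (fbundle Psi) => //; split=> //.
- apply/funext => g.
  by rewrite /picard (fiber_bimod_factor_bundle psi_pic fS) -psiF.
- have [Phi eP] := fell_equivalent_refl (fbundle Psi).
  by exists Phi; exact: fequiv_banach eP.
by exists Psi => //; exact: fell_equivalent_refl.
Qed.

Lemma ExtP x : Ext psi tau x ->
  exists2 Psi : product, fell_factor_system psi tau Psi &
    x = fell_class (fbundle Psi).
Proof.
move=> [E -> [_ _ _ [Psi ffs /fell_class_eq e]]].
by exists Psi.
Qed.

Lemma twist_fell_factor_system omega (Psi : product) :
  cocycle2 psi omega -> fell_factor_system psi tau Psi ->
  fell_factor_system psi tau (twisted omega Psi).
Proof.
move=> cO [fS fB]; split; first exact: twist_factor_system.
exact: (twist_saturated psi_pic fS fB cO).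
Qed.

(** All representatives of both classes are admitted at once, so that the
    action is defined without a choice; ext_actE shows that they agree. *)
Definition ext_act (c : set (G -> G -> B)) (x : fell_data G B -> Prop) :
    fell_data G B -> Prop :=
  fun E => exists omega (Psi : product),
    [/\ c omega, cocycle2 psi omega, fell_factor_system psi tau Psi,
      x = fell_class (fbundle Psi) &
      fell_class (fbundle (twisted omega Psi)) E].

Lemma ext_actE omega (Psi : product) : cocycle2 psi omega ->
  fell_factor_system psi tau Psi ->
  ext_act (H2_class psi omega) (fell_class (fbundle Psi)) =
  fell_class (fbundle (twisted omega Psi)).
Proof.
move=> cO fPsi; apply/funext => E; apply/propext; split; last first.
  by exists omega, Psi; split=> //; exact: H2_class_refl.
move=> [omega' [Psi' [[_ coh] cO' fPsi' e]]].
suff -> : fell_class (fbundle (twisted omega' Psi')) =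
  fell_class (fbundle (twisted omega Psi)) by [].
have [fS fB] := fPsi; have [fS' fB'] := fPsi'.
have eP := fell_class_inj fB' e.
transitivity (fell_class (fbundle (twisted omega' Psi))); apply: fell_class_eq.
  apply: fell_equivalent_sym.
  exact: (twist_equivalent psi_pic fS fS' cO' eP).
apply: fell_equivalent_sym.
exact: (twist_equivalent_cohomologous psi_pic fS fB cO cO' coh).
Qed.

End ExtAction.

(** * Simple transitivity *)

Theorem corollary4p17 (R : realType) (G : topGroupType)
    (hausdorffG : hausdorff_space G)
    (locally_compactG : locally_compact [set: G])
    (B : cstarAlgType R)
    (psi : G -> bimod B -> Prop) (hpsi : topological_picard_morphism psi)
    (F : fell_data G B) (hF : saturated_fell_bundle F)
    (hFpsi : picard F = psi)
    (lambda : {measure set (borel G) -> \bar R}) (hlambda : left_haar lambda)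
    (Delta : G -> R) (hDelta : modular_function lambda Delta)
    (Gamma : set (forall g, fib F g))
    (hGamma : fundamental_family lambda Delta Gamma)
    (tau : topology_on (total_space (fib F)))
    (htau : topology_determined_by Gamma tau) :
  exists act : set (G -> G -> B) -> (fell_data G B -> Prop) ->
      (fell_data G B -> Prop),
  [/\ forall c x, H2 psi c -> Ext psi tau x -> Ext psi tau (act c x) &
      forall omega (Psi : forall g h, fib F g -> fib F h -> fib F (g * h)%g),
        cocycle2 psi omega -> fell_factor_system psi tau Psi ->
        [/\ Ext psi tau (fell_class
              (factor_bundle (M := fiber_bimod F) (funit F) tau Psi)),
            fell_factor_system psi tau (twist (M := fiber_bimod F) omega Psi) &
            act (H2_class psi omega) (fell_class
              (factor_bundle (M := fiber_bimod F) (funit F) tau Psi)) =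
            fell_class (factor_bundle (M := fiber_bimod F) (funit F) tau
              (twist (M := fiber_bimod F) omega Psi))]] /\
  [/\ forall x, Ext psi tau x -> act (H2_one psi) x = x &
      forall c d x, H2 psi c -> H2 psi d -> Ext psi tau x ->
        act (H2_mul psi c d) x = act c (act d x)] /\
  [/\ exists x, Ext psi tau x &
      forall x y, Ext psi tau x -> Ext psi tau y ->
        exists! c, H2 psi c /\ act c x = y].
Proof.
have [[psi_pic _] _] := hpsi.
have base : fell_factor_system psi tau (@fmul R G B F).
  split; first exact: fell_bundle_factor_system.
  rewrite (factor_bundle_fmul psi_pic hF hFpsi).
  by split; [exact: htau.1|exact: hF.2].
exists (ext_act psi tau); split; [split|split; split].
- move=> c x [omega cO <-] /(ExtP) [Psi fPsi ->].
  rewrite ext_actE//; apply: Ext_factor_bundle => //.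
  exact: twist_fell_factor_system.
- move=> omega Psi cO fPsi; split.
  + exact: Ext_factor_bundle.
  + exact: twist_fell_factor_system.
  + exact: ext_actE.
- move=> x /ExtP [Psi fPsi ->].
  rewrite /H2_one ext_actE//; last exact: cocycle2_one.
  by rewrite (twist_one psi_pic fPsi.1).
- move=> c d x [omega cO <-] [omega' cO' <-] /ExtP [Psi fPsi ->].
  rewrite H2_mul_class// !ext_actE//; last 2 first.
  + exact: twist_fell_factor_system.
  + exact: cocycle2_mul.
  by rewrite (twist_mul psi_pic _ _ fPsi.1).
- exists (fell_class (factor_bundle (M := fiber_bimod F) (funit F) tau
    (@fmul R G B F))).
  exact: Ext_factor_bundle.
move=> x y /ExtP [Psi fPsi ->] /ExtP [Psi' fPsi' ->].
have [omega cO oE] := factor_systems_differ_by_cocycle psi_pic fPsi.1 fPsi'.1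
  fPsi.2 fPsi'.2.
exists (H2_class psi omega); split.
  by split; [exists omega|rewrite ext_actE// oE].
move=> _ [[omega' cO' <-]]; rewrite ext_actE// -oE => e.
apply: H2_class_eq => //.
have sat := (twist_fell_factor_system psi_pic cO' fPsi).2.
apply: (cohomologous_twist_equivalent psi_pic fPsi.1 fPsi.2 cO cO').
exact: (fell_class_inj sat (esym e)).
Qed.
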